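(* Let $G$ be a graph with maximum degree $\Delta(G)$ and incidence chromatic number $\chi_i(G)$. 1. If ${\rm mad}(G)<4$ and $\Delta(G)\geq 7$, then $\chi_i(G)\leq \Delta(G)+3$. 2. If ${\rm mad}(G)<\frac{9}{2}$ and $\Delta(G)\geq 9$, then $\chi_i(G)\leq \Delta(G)+4$. 3. If ${\rm mad}(G)<5$ and ($\Delta(G)\geq 9$ or $\Delta(G)\leq 5$), then $\chi_i(G)\leq \Delta(G)+5$. 4. If ${\rm mad}(G)<5$ and $6\leq \Delta(G)\leq 8$, then $\chi_i(G)\leq \Delta(G)+6$. 5. If ${\rm mad}(G)<6$ and ($\Delta(G)\geq 12$ or $\Delta(G)\leq 6$), then $\chi_i(G)\leq \Delta(G)+6$. 6. If ${\rm mad}(G)<6$ and $7\leq \Delta(G)\leq 11$, then $\chi_i(G)\leq \Delta(G)+7$.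
   Context: All graphs are simple, finite, non-empty and connected. An incidence of $G$ is a pair $(v,e)$ with $v$ a vertex and $e$ an edge incident to $v$. Two incidences $(u,e)$ and $(v,f)$ are adjacent if $u=v$, or $e=f$, or $uv=e$ or $uv=f$. An incidence coloring assigns colors to incidences so that adjacent incidences receive distinct colors; $\chi_i(G)$ is the least integer $k$ such that $G$ has an incidence coloring with colors in $\{1,\dots,k\}$. ${\rm mad}(G)=\max\{2|E(H)|/|V(H)| : H\subseteq G\}$. *)

(* Defs.v *)
From mathcomp Require Import all_boot all_order all_algebra.

Set Implicit Arguments.
Unset Strict Implicit.
Unset Printing Implicit Defensive.

(* A graph is an adjacency relation [e] on a finite type [T] of vertices. *)
Section Graphs.

Variables (T : finType) (e : rel T).

Definition simple_graph : Prop := symmetric e /\ irreflexive e.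

Definition nonempty_graph : Prop := 0 < #|T|.

Definition connected_graph : Prop := forall x y : T, connect e x y.

Definition edges : {set {set T}} :=
  [set [set p.1; p.2] | p : T * T & e p.1 p.2].

Definition degree (x : T) : nat := #|[set y | e x y]|.

Definition max_degree : nat := \max_(x : T) degree x.

(* A subgraph is a pair (vertex set, edge set); it need not be induced, nor
   connected. *)
Definition is_subgraph (H : {set T} * {set {set T}}) : bool :=
  [&& H.1 != set0, H.2 \subset edges & [forall f in H.2, f \subset H.1]].

(* The base value 0 is harmless: the ratios are nonnegative, and on a nonempty
   vertex type a single vertex is a subgraph of ratio 0. *)
Definition mad : rat :=
  \big[Order.max/0%R]_(H : {set T} * {set {set T}} | is_subgraph H)
    (2 * #|H.2|%:R / #|H.1|%:R)%R.

Definition is_incidence (i : T * {set T}) : bool :=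
  (i.2 \in edges) && (i.1 \in i.2).

Definition incidence : finType := {i : T * {set T} | is_incidence i}.

Definition inc_vertex (i : incidence) : T := (val i).1.

Definition inc_edge (i : incidence) : {set T} := (val i).2.

Definition inc_adj (i j : incidence) : bool :=
  (i != j) &&
  [|| inc_vertex i == inc_vertex j,
      inc_edge i == inc_edge j,
      [set inc_vertex i; inc_vertex j] == inc_edge i
    | [set inc_vertex i; inc_vertex j] == inc_edge j].

(* The colors 1, ..., k are represented by 'I_k. *)
Definition incidence_coloring (k : nat) (c : {ffun incidence -> 'I_k}) : bool :=
  [forall i, forall j, inc_adj i j ==> (c i != c j)].

Definition incidence_colorable (k : nat) : bool :=
  [exists c : {ffun incidence -> 'I_k}, incidence_coloring c].

Lemma ex_incidence_colorable : exists k, incidence_colorable k.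
Proof.
exists #|incidence|; apply/existsP; exists [ffun i => enum_rank i].
apply/forallP => i; apply/forallP => j; apply/implyP => /andP[neq_ij _].
by rewrite !ffunE (inj_eq enum_rank_inj).
Qed.

Definition incidence_chromatic_number : nat := ex_minn ex_incidence_colorable.

End Graphs.

(* Main.v *)
(* An incidence (u, uv) is the arc u -> v of the symmetric digraph of G, and an
   incidence colouring is an arc colouring for which the arcs leaving a vertex
   have distinct colours, none of which occurs on an arc entering it. With
   M + t colours, M being the maximum degree, we ask in addition that at most t
   colours enter each vertex. If an arc u -> v with deg u small reuses a colour
   entering v, this cap survives; hence a minimal counterexample contains no
   vertex of degree k with 2k <= t + 1, all neighbours of a k-vertex with
   2k <= t + 2 have degree M, and a few other configurations around light
   vertices are excluded. Vertices of large degree can then give charge to the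
   light ones so that every vertex ends up with at least the bound on mad(G).
   When M is small, 2M colours suffice: label the arcs leaving each vertex
   injectively by 1, ..., M with as many edges as possible labelled equally at
   both ends. Then a label class has no directed cycle of length above 2, so two
   colours per label are enough. *)

Require Import Defs.
From mathcomp Require Import all_boot all_order all_algebra.
From mathcomp Require Import zify.
From Stdlib Require Import Classical.

Set Implicit Arguments.
Unset Strict Implicit.
Unset Printing Implicit Defensive.

(** * Transversals and hitting sets *)

Ltac nat_arith :=
  repeat match goal with
  | H : ?P |- _ => lazymatch P with
      | is_true (leq _ _) => fail
      | @eq nat _ _ => fail
      | ~ @eq nat _ _ => fail
      | _ => clear H
      end
  end; lia.

Section Selection.

Variables (T C : finType).
Implicit Types (U : {set T}) (L : T -> {set C}) (A B : {set C}).

Lemma exists_notin A B : #|B| < #|A| -> exists2 x, x \in A & x \notin B.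
Proof.
move=> ltBA; have /subsetPn[x xA xB]: ~~ (A \subset B).
  by apply/negP => /subset_leq_card; rewrite leqNgt ltBA.
by exists x.
Qed.

Lemma card_setD_leq A B : #|A| <= #|A :\: B| + #|B|.
Proof. by rewrite -(cardsID B A) addnC leq_add2l subset_leq_card ?subsetIr. Qed.

Lemma card_setU_leq A B : #|A :|: B| <= #|A| + #|B|.
Proof. exact: (leq_card_setU A B).1. Qed.

(** A system of distinct representatives of the lists [L u] with [u] in [U]. *)
Definition transversal_of U L (a : T -> C) :=
  {in U, forall u, a u \in L u} /\ {in U &, injective a}.

Lemma transversal_add U L a u x :
  u \in U -> x \in L u -> transversal_of (U :\ u) L a ->
  {in U :\ u, forall w, a w != x} ->
  transversal_of U L (fun w => if w == u then x else a w).
Proof.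
move=> uU xL [aL a_inj] ax; split=> [w wU|w1 w2 w1U w2U].
  by have [->//|wu] := eqVneq w u; apply: aL; rewrite !inE wu.
have [->|w1u] := eqVneq w1 u; have [->|w2u] // := eqVneq w2 u.
- by move=> xa; have := ax w2; rewrite !inE w2u w2U -xa eqxx => /(_ isT).
- by move=> xa; have := ax w1; rewrite !inE w1u w1U xa eqxx => /(_ isT).
- by apply: a_inj; rewrite !inE ?w1u ?w2u.
Qed.

Lemma transversal_large (x0 : C) U L :
  {in U, forall u, #|U| <= #|L u|} -> exists a, transversal_of U L a.
Proof.
move En : #|U| => n; elim: n U En => [|n IHn] U Un UL.
  exists (fun=> x0); have -> : U = set0 by apply/eqP; rewrite -cards_eq0 Un.
  by split=> u; rewrite !inE.
have /card_gt0P[j jU] : 0 < #|U| by rewrite Un.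
have Ujn : #|U :\ j| = n by move: (cardsD1 j U); rewrite jU; lia.
have [||a atr] := IHn (U :\ j) => //.
  by move=> u; rewrite !inE => /andP[_ /UL]; lia.
have [|x xL xa] := @exists_notin (L j) (a @: (U :\ j)).
  by apply: leq_ltn_trans (leq_imset_card _ _) _; rewrite Ujn UL.
exists (fun w => if w == j then x else a w); apply: transversal_add => //.
by move=> w wU; apply: contraNneq xa => <-; apply: imset_f.
Qed.

(** All other vertices are served greedily before [j], so their lists may be one colour shorter. *)
Lemma transversal_last (x0 : C) U L j :
  j \in U -> {in U, forall u, #|U| <= #|L u|.+1} -> #|U| <= #|L j| ->
  exists a, transversal_of U L a.
Proof.
move=> jU UL jL; have UjE := cardsD1 j U; rewrite jU in UjE.
have [|a atr] := @transversal_large x0 (U :\ j) L.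
  by move=> u; rewrite !inE => /andP[_ /UL]; lia.
have [|x xL xa] := @exists_notin (L j) (a @: (U :\ j)).
  by apply: leq_ltn_trans (leq_imset_card _ _) _; lia.
exists (fun w => if w == j then x else a w); apply: transversal_add => //.
by move=> w wU; apply: contraNneq xa => <-; apply: imset_f.
Qed.

(* Assigning to [i] a colour missing from [L j] lets [j] be served last. *)
Lemma transversal_distinct (x0 : C) U L i j x :
  i \in U -> j \in U -> {in U, forall u, #|U| <= #|L u|.+1} ->
  x \in L i -> x \notin L j -> exists a, transversal_of U L a.
Proof.
move=> iU jU UL xi xj; have UiE := cardsD1 i U; rewrite iU in UiE.
have ji : j != i by apply: contraNneq xj => ->.
have Lx u := cardsD1 x (L u).
have [|||a [aL a_inj]] :=
  @transversal_last x0 (U :\ i) (fun u => L u :\ x) j.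
- by rewrite !inE ji.
- by move=> u; rewrite !inE => /andP[_ /UL]; have := Lx u; case: (x \in L u); lia.
- by have := Lx j; have := UL j jU; rewrite (negPf xj); lia.
exists (fun w => if w == i then x else a w); apply: transversal_add => //.
  by split=> // u /aL; rewrite !inE => /andP[].
by move=> w /aL; rewrite !inE => /andP[].
Qed.

(** Double counting of the pairs of a vertex [u] and a colour of [L u]: a colour of [X] in the most
    lists reaches the average. *)
Lemma popular_color U L (X : {set C}) s :
  X != set0 -> {in U, forall u, L u \subset X} ->
  {in U, forall u, s <= #|L u|} ->
  exists x, #|U| * s <= #|X| * #|[set u in U | x \in L u]|.
Proof.
move=> /set0Pn[x0 x0X] LX Ls.
pose f x := #|[set u in U | x \in L u]|.
have [x xX fmax] := arg_maxnP f x0X; exists x.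
have -> : #|U| * s = \sum_(u in U) s by rewrite sum_nat_const.
apply: (@leq_trans (\sum_(u in U) \sum_(y in X) (y \in L u))).
  apply: leq_sum => u uU; apply: leq_trans (Ls u uU) _.
  rewrite -sum1_card big_mkcond [leqRHS]big_mkcond; apply: leq_sum => y _.
  by case: (boolP (y \in L u)) => // yL; rewrite (subsetP (LX u uU)).
rewrite exchange_big -sum_nat_const; apply: leq_sum => y yX.
rewrite (leq_trans _ (fmax y yX)) // /f -sum1_card [leqRHS]big_mkcond.
rewrite [leqLHS]big_mkcond; apply: leq_sum => u _; rewrite inE.
by case: (u \in U); case: (y \in L u).
Qed.

(* Some colour lies in more than [p %/ r] of any [p] of the lists, so a greedy
   choice leaves at most [p - (p %/ r).+1] of them. *)
Lemma hitting_set r h U L (X : {set C}) :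
  {in U, forall u, L u \subset X} ->
  {in U, forall u, #|X| < r * #|L u|} ->
  iter h (fun p => p - (p %/ r).+1) #|U| = 0 ->
  exists2 H : {set C}, #|H| <= h & {in U, forall u, exists2 x, x \in L u & x \in H}.
Proof.
move=> LX Lr; elim: h U LX Lr => [|h IHh] U LX Lr hU.
  exists set0; rewrite ?cards0 // => u uU.
  by move: hU => /= /eqP; rewrite cards_eq0 => /eqP U0; rewrite U0 inE in uU.
have [U0|[u0 u0U]] := set_0Vmem U.
  by exists set0; rewrite ?cards0 // => u; rewrite U0 inE.
have X0 : X != set0.
  apply: contraTneq (Lr u0 u0U) => X0.
  have := LX u0 u0U; rewrite X0 subset0 => /eqP ->.
  by rewrite cards0 muln0.
have [x xU] : exists x, #|U| %/ r < #|[set u in U | x \in L u]|.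
  have r0 : 0 < r by have := Lr u0 u0U; case: (r); rewrite ?mul0n.
  have [|x xP] := @popular_color U L X (#|X| %/ r).+1 X0 LX.
    by move=> u uU; rewrite ltn_divLR // mulnC Lr.
  exists x; rewrite ltn_divLR //.
  have X1 : 0 < #|X| by rewrite card_gt0.
  have Xr : #|X| < (#|X| %/ r).+1 * r by rewrite -ltn_divLR.
  have U1 : 0 < #|U| by apply/card_gt0P; exists u0.
  set q := #|[set _ in U | _]| in xP *.
  rewrite -(ltn_pmul2l X1); apply: (@leq_trans (#|U| * ((#|X| %/ r).+1 * r))).
    by rewrite mulnC ltn_pmul2l.
  by rewrite !mulnA leq_pmul2r.
pose V := [set u in U | x \notin L u].
have UV : #|V| + #|[set u in U | x \in L u]| = #|U|.
  rewrite -(cardsID [set u | x \in L u] U) addnC; congr (_ + _); apply: eq_card => u.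
    by rewrite !inE.
  by rewrite !inE andbC.
(* Fewer lists may be left than the bound allows; the iteration is monotone because [q' %/ r]
   exceeds [p' %/ r] by at most [q' - p']. *)
have monot p q n : p <= q ->
    iter n (fun p => p - (p %/ r).+1) p <= iter n (fun p => p - (p %/ r).+1) q.
  move=> pq; elim: n => //= n; set p' := iter _ _ p; set q' := iter _ _ q => pq'.
  case: (posnP r) => [->|r0]; first by rewrite !divn0; lia.
  have : q' %/ r <= p' %/ r + (q' - p').
    rewrite -{1}(subnKC pq') (addnC (p' %/ r)) -(divnMDl _ _ r0) leq_div2r //.
    by rewrite addnC leq_add2r leq_pmulr.
  by lia.
have [||| H Hh HP] := IHh V.
- by move=> u; rewrite inE => /andP[/LX].
- by move=> u; rewrite inE => /andP[/Lr].
- apply/eqP; rewrite -leqn0 -hU iterSr; apply: monot.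
  by move: xU UV; lia.
exists (x |: H); first by rewrite cardsU1; case: (x \in H); lia.
move=> u uU; have [xL|xL] := boolP (x \in L u).
  by exists x => //; rewrite !inE eqxx.
by have [|y yL yH] := HP u; [rewrite inE uU | exists y; rewrite // !inE yH orbT].
Qed.

End Selection.

(** * Arc colourings and stars *)

Section ArcColoring.

Variables (T C : finType).
Implicit Types (e : rel T) (c : T -> T -> C) (U : {set T}) (a b : T -> C).

Definition nbrs e x : {set T} := [set y | e x y].

Definition out_colors e c x : {set C} := [set c x y | y in nbrs e x].

Definition in_colors e c x : {set C} := [set c y x | y in nbrs e x].

(* [c x y] is the colour of the incidence [(x, {x, y})]. *)
Definition arc_coloring e c : Prop :=
  (forall x y z, e x y -> e x z -> c x y = c x z -> y = z) /\
  (forall x y z, e x y -> e y z -> c x y != c y z).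

(* The cap leaves a free colour for an arc from a vertex of maximum degree [M]
   into a new neighbour when there are [M + t] colours. *)
Definition colored_by t e c : Prop :=
  arc_coloring e c /\ forall x, #|in_colors e c x| <= t.

Lemma card_out_colors e c x : #|out_colors e c x| <= degree e x.
Proof. exact: leq_imset_card. Qed.

Lemma card_in_colors e c x : #|in_colors e c x| <= degree e x.
Proof. exact: leq_imset_card. Qed.

Lemma mem_out_colors e c x y : e x y -> c x y \in out_colors e c x.
Proof. by move=> xy; apply/imsetP; exists y; rewrite ?inE. Qed.

Lemma mem_in_colors e c x y : symmetric e -> e x y -> c x y \in in_colors e c y.
Proof. by move=> e_sym xy; apply/imsetP; exists x; rewrite ?inE // e_sym. Qed.

Lemma out_in_colors e c x : symmetric e -> arc_coloring e c ->
  [disjoint out_colors e c x & in_colors e c x].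
Proof.
move=> e_sym [_ c2]; apply/pred0P => k /=; apply/negP => /andP[].
move=> /imsetP[y]; rewrite inE => xy -> /imsetP[z]; rewrite inE e_sym => zx eq_c.
by have := c2 _ _ _ zx xy; rewrite eq_c eqxx.
Qed.

Definition cut_star e v U : rel T :=
  fun x y => e x y && ~~ ((x == v) && (y \in U) || (y == v) && (x \in U)).

Definition recolor_star c v U a b : T -> T -> C := fun x y =>
  if (x == v) && (y \in U) then a y
  else if (y == v) && (x \in U) then b x else c x y.

Lemma cut_star_sym e v U : symmetric e -> symmetric (cut_star e v U).
Proof. by move=> e_sym x y; rewrite /cut_star e_sym orbC. Qed.

Lemma cut_star_sub e v U : subrel (cut_star e v U) e.
Proof. by move=> x y /andP[]. Qed.

Lemma degree_sub e e' x : subrel e' e -> degree e' x <= degree e x.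
Proof. by move=> sub; apply/subset_leq_card/subsetP => y; rewrite !inE => /sub. Qed.

Lemma degree_cut_center e v U : U \subset nbrs e v ->
  degree (cut_star e v U) v + #|U| <= degree e v.
Proof.
move=> Uv; rewrite /degree -(cardsID U [set y | e v y]) addnC leq_add //.
  by rewrite subset_leq_card // subsetI Uv subxx.
apply/subset_leq_card/subsetP => y; rewrite !inE /cut_star eqxx /= negb_or.
by move=> /and3P[-> -> ].
Qed.

Lemma degree_cut_leaf e v U u : symmetric e -> irreflexive e ->
  U \subset nbrs e v -> u \in U ->
  degree (cut_star e v U) u < degree e u.
Proof.
move=> e_sym e_irr Uv uU; have := subsetP Uv _ uU; rewrite inE => vu.
apply/proper_card/properP; split.
  by apply/subsetP => y; rewrite !inE => /andP[].
by exists v; rewrite !inE /cut_star ?uU ?eqxx ?orbT ?andbF // e_sym.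
Qed.

Section Recolor.

Variables (e : rel T) (v : T) (U : {set T}) (c : T -> T -> C) (a b : T -> C).
Variable t : nat.
Hypotheses (e_sym : symmetric e) (e_irr : irreflexive e).
Hypothesis Uv : U \subset nbrs e v.

Let e' := cut_star e v U.
Let c' := recolor_star c v U a b.

Hypothesis c_col : colored_by t e' c.
Hypothesis aP : {in U, forall u,
  [/\ a u \notin out_colors e' c v, a u \notin in_colors e' c v &
      a u \notin out_colors e' c u]}.
Hypothesis a_inj : {in U &, injective a}.
Hypothesis ab : {in U &, forall u w, a u != b w}.
Hypothesis bP : {in U, forall u,
  [/\ b u \notin out_colors e' c u, b u \notin in_colors e' c u &
      b u \notin out_colors e' c v]}.
Hypothesis v_cap : #|in_colors e' c v :|: b @: U| <= t.
Hypothesis u_cap : {in U, forall u, #|a u |: in_colors e' c u| <= t}.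

Let v_notin : v \notin U.
Proof. by apply/negP => /(subsetP Uv); rewrite inE e_irr. Qed.

Let cut_sym : symmetric e'.
Proof. exact: cut_star_sym. Qed.

(** The hypotheses cover every conflict of a new arc with an old arc or with another new arc. Arcs
    with a common head may share a colour, so [b] may repeat values, which helps the cap at [v]. *)
Lemma recolor_starP : colored_by t e c'.
Proof.
have [[c1 c2] c_cap] := c_col.
have cut x y : e x y -> [\/ x = v /\ y \in U, y = v /\ x \in U |
    e' x y /\ c' x y = c x y].
  rewrite /e' /c' /recolor_star /cut_star => ->.
  case: (boolP ((x == v) && _)) => [/andP[/eqP-> yU]|_]; first by constructor 1.
  by case: (boolP ((y == v) && _)) => [/andP[/eqP-> xU]|_]; [constructor 2|constructor 3].
have ca y : y \in U -> c' v y = a y by rewrite /c' /recolor_star eqxx => ->.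
have cb x : x \in U -> c' x v = b x.
  by move=> xU; rewrite /c' /recolor_star (negPf v_notin) andbF eqxx xU.
split; first split.
- move=> x y z xy xz.
  case: (cut x y xy) => [[xv yU]|[yv xU]|[xy' ->]].
  + subst x; rewrite ca //; case: (cut v z xz) => [[_ zU]|[_ vU]|[xz' ->]].
    * by rewrite ca //; apply: a_inj.
    * by case/negP: v_notin.
    * by move=> eq_a; have [] := aP yU; rewrite eq_a mem_out_colors.
  + subst y; rewrite cb //; case: (cut x z xz) => [[xv _]|[-> _]|[xz' ->]] //.
    * by rewrite xv (negPf v_notin) in xU.
    * by move=> eq_b; have [] := bP xU; rewrite eq_b mem_out_colors.
  + case: (cut x z xz) => [[xv zU]|[zv xU]|[xz' ->]]; last exact: c1.
    * subst x; rewrite ca // => eq_a; have [] := aP zU.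
      by rewrite -eq_a mem_out_colors.
    * subst z; rewrite cb // => eq_b; have [] := bP xU.
      by rewrite -eq_b mem_out_colors.
- move=> x y z xy yz.
  case: (cut x y xy) => [[xv yU]|[yv xU]|[xy' ->]].
  + subst x; rewrite ca //; case: (cut y z yz) => [[yv _]|[zv _]|[yz' ->]].
    * by rewrite yv (negPf v_notin) in yU.
    * by subst z; rewrite cb //; apply: ab.
    * by have [_ _] := aP yU; apply: contraNneq => ->; apply: mem_out_colors.
  + subst y; rewrite cb //; case: (cut v z yz) => [[_ zU]|[_ vU]|[yz' ->]].
    * by rewrite ca // eq_sym; apply: ab.
    * by case/negP: v_notin.
    * by have [_ _] := bP xU; apply: contraNneq => ->; apply: mem_out_colors.
  + case: (cut y z yz) => [[yv zU]|[zv yU]|[yz' ->]]; last exact: c2 xy' yz'.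
    * subst y; rewrite ca //; have [_ + _] := aP zU.
      by apply: contraNneq => <-; apply: mem_in_colors.
    * subst z; rewrite cb //; have [_ + _] := bP yU.
      by apply: contraNneq => <-; apply: mem_in_colors.
- move=> x; have [->|xv] := eqVneq x v.
    apply: leq_trans v_cap; apply/subset_leq_card/subsetP => k /imsetP[y].
    rewrite !inE e_sym => yv ->.
    case: (cut y v yv) => [[_ vU]|[_ yU]|[yv' ->]].
    + by rewrite (negPf v_notin) in vU.
    + by rewrite cb // imset_f ?orbT.
    + by rewrite mem_in_colors.
  have [xU|xU] := boolP (x \in U).
    apply: leq_trans (u_cap xU); apply/subset_leq_card/subsetP => k /imsetP[y].
    rewrite !inE e_sym => yx ->.
    case: (cut y x yx) => [[-> _]|[xv' _]|[yx' ->]].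
    + by rewrite ca ?eqxx.
    + by rewrite xv' eqxx in xv.
    + by rewrite mem_in_colors ?orbT.
  apply: leq_trans (c_cap x); apply/subset_leq_card/subsetP => k /imsetP[y].
  rewrite !inE e_sym => yx ->.
  case: (cut y x yx) => [[_ xU']|[xv' _]|[yx' ->]].
  + by rewrite xU' in xU.
  + by rewrite xv' eqxx in xv.
  + by rewrite mem_in_colors.
Qed.

(** Serves to tell two leaves of a later star apart by the colours leaving them. *)
Lemma out_colors_recolor x : x != v -> x \notin U ->
  out_colors e c' x = out_colors e' c x.
Proof.
move=> xv xU; rewrite /out_colors; have -> : nbrs e x = nbrs e' x.
  by apply/setP => y; rewrite !inE /e' /cut_star (negPf xv) (negPf xU) andbF andbT.
apply: eq_in_imset => y _.
by rewrite /c' /recolor_star (negPf xv) (negPf xU) andbF.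
Qed.

End Recolor.

End ArcColoring.

(** * Lists at a removed vertex *)

Section Reducibility.

Variables (T C : finType) (M t : nat).
Hypothesis card_C : #|C| = M + t.
Implicit Types (e : rel T) (c : T -> T -> C) (U B : {set T}) (a b : T -> C).

Definition colorable_by e : Prop := exists c, colored_by t e c.

(** A counterexample minimal under edge deletion. The vertex type is fixed and [M] only bounds the
    degrees, so subgraphs of the original graph, connected or not, are covered. *)
Definition critical e : Prop :=
  [/\ symmetric e, irreflexive e, forall x, degree e x <= M, ~ colorable_by e &
      forall e', symmetric e' -> subrel e' e ->
        (exists x y, e x y && ~~ e' x y) -> colorable_by e'].

Lemma critical_cut e v U u : critical e -> U \subset nbrs e v -> u \in U ->
  colorable_by (cut_star e v U).
Proof.
move=> [e_sym _ _ _ crit] Uv uU; apply: crit.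
- exact: cut_star_sym.
- exact: cut_star_sub.
- exists v, u; have := subsetP Uv _ uU; rewrite inE => vu.
  by rewrite /cut_star vu eqxx uU.
Qed.

(* Colours for the arcs from a leaf [w] to the centre of a removed star, and from
   the centre to [w]. *)
Definition inward_list e c w := ~: (out_colors e c w :|: in_colors e c w).

(* Reusing a colour of [in_colors] once there are [t] of them preserves the cap. *)
Definition outward_list e c w :=
  if #|in_colors e c w| < t then ~: out_colors e c w else in_colors e c w.

Section VertexLists.

Variables (e : rel T) (v : T) (c : T -> T -> C).
Hypotheses (e_sym : symmetric e) (e_irr : irreflexive e).

Let N := nbrs e v.
Let e' := cut_star e v N.

Hypothesis c_col : colored_by t e' c.

Let F := outward_list e' c.
Let K := inward_list e' c.

Lemma leaf_degree w : w \in N -> degree e' w < degree e w.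
Proof. exact: degree_cut_leaf. Qed.

(** Without its edge to [v], fewer than [degree e w] colours leave [w] and, by the cap, at most [t]
    enter it. *)
Lemma card_inward_list w : w \in N -> M < #|K w| + degree e w.
Proof.
move=> wN; have := leaf_degree wN; have := c_col.2 w.
have := card_out_colors e' c w; have := cardsC (out_colors e' c w :|: in_colors e' c w).
have := card_setU_leq (out_colors e' c w) (in_colors e' c w).
by rewrite card_C /K /inward_list; lia.
Qed.

(** If the cap is reached at [w], then [F w] consists of the colours entering [w], which [K w]
    avoids; otherwise it lacks only the colours leaving [w]. *)
Lemma outward_list_dichotomy w : w \in N ->
  ([disjoint F w & K w] /\ #|F w| = t) \/ M + t < #|F w| + degree e w.
Proof.
move=> wN; rewrite /F /outward_list; case: ifPn => [_|in_t]; last left.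
  right; have := leaf_degree wN; have := card_out_colors e' c w.
  by have := cardsC (out_colors e' c w); rewrite card_C; lia.
split; last by have := c_col.2 w; lia.
by apply/pred0P => k; rewrite /= !inE; case: (k \in in_colors e' c w); rewrite ?orbT.
Qed.

Lemma isolated_center : out_colors e' c v = set0 /\ in_colors e' c v = set0.
Proof.
suff nb0 : nbrs e' v = set0 by rewrite /out_colors /in_colors nb0 !imset0.
apply/setP => y; rewrite !inE /e' /cut_star eqxx !inE /=.
by case: (e v y).
Qed.

Lemma outward_list_notin_out w k : k \in F w -> k \notin out_colors e' c w.
Proof.
rewrite /F /outward_list; case: ifP => _; first by rewrite inE.
have := out_in_colors w (cut_star_sym v N e_sym) c_col.1.
by rewrite disjoint_sym => /disjointFr h /h ->.
Qed.

Lemma recolor_vertexP a b :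
  {in N, forall w, a w \in F w} -> {in N, forall w, b w \in K w} ->
  {in N &, injective a} -> {in N &, forall u w, a u != b w} ->
  #|b @: N| <= t -> colored_by t e (recolor_star c v N a b).
Proof.
move=> aF bK a_inj ab bt.
have [out0 in0] := isolated_center.
apply: recolor_starP; rewrite // -/N -/e' ?out0 ?in0 ?set0U //.
- by move=> w wN; rewrite !inE; split=> //; apply: outward_list_notin_out; apply: aF.
- by move=> w wN; have := bK w wN; rewrite !inE negb_or => /andP[-> ->].
move=> w wN; have := aF w wN; rewrite /F /outward_list; case: ifPn => [in_t _|_ a_in].
  by rewrite cardsU1; case: (_ \notin _); lia.
by rewrite setUC (setUidPl _) ?sub1set //; apply: c_col.2.
Qed.

End VertexLists.

(* A colour of [K w] only meets [F w] when [F w] is larger than [t]. *)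
Lemma outward_list_remains (F K B : {set C}) x d :
  ([disjoint F & K] /\ #|F| = t) \/ M + t < #|F| + d -> d <= M ->
  x \in K -> x \in B -> t < #|F :\: B| + #|B|.
Proof.
move=> FK dM xK xB; have := card_setD_leq F B; case: FK => [[dis Ft]|]; last by lia.
have xF : x \notin F by rewrite (disjointFl dis xK).
have := card_setD_leq F (B :\ x); have := cardsD1 x B; rewrite xB.
suff -> : F :\: (B :\ x) = F :\: B by lia.
apply/setP => y; rewrite !inE negb_and negbK.
by have [->|] := eqVneq y x; rewrite // (negPf xF) !andbF.
Qed.

(** Of a colouring without the edges at [v], only the list sizes and a disjointness are kept. Since
    [degree e v <= t], the cap at [v] holds for every [b], so an extension can fail only by a clash
    between [a] and [b]. *)
Lemma critical_lists e v : critical e -> 0 < degree e v <= t ->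
  exists F K : T -> {set C},
  [/\ {in nbrs e v, forall w, M < #|K w| + degree e w},
      {in nbrs e v, forall w, ([disjoint F w & K w] /\ #|F w| = t) \/
                              M + t < #|F w| + degree e w} &
      forall a b, transversal_of (nbrs e v) F a ->
        {in nbrs e v, forall w, b w \in K w} ->
        exists u w, [/\ u \in nbrs e v, w \in nbrs e v & a u = b w]].
Proof.
move=> crit /andP[dv0 dvt]; have [e_sym e_irr _ no_col _] := crit.
have /card_gt0P[u uN] := dv0.
have [c c_col] := critical_cut crit (subxx _) uN.
exists (outward_list (cut_star e v (nbrs e v)) c).
exists (inward_list (cut_star e v (nbrs e v)) c); split.
- exact: card_inward_list.
- exact: outward_list_dichotomy.
move=> a b [aF a_inj] bK; apply: NNPP => no_eq; apply: no_col.
exists (recolor_star c v (nbrs e v) a b); apply: recolor_vertexP => //.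
  move=> x y xN yN; apply/eqP => eq_ab; apply: no_eq.
  by exists x, y.
by apply: leq_trans (leq_imset_card _ _) _.
Qed.

End Reducibility.

(** * Reducible configurations *)

Section Configurations.

Variables (T C : finType) (M t : nat).
Hypothesis card_C : #|C| = M + t.
Implicit Types (e : rel T) (c : T -> T -> C) (U B : {set T}) (a b : T -> C).

Lemma choose_colors (x0 : C) U (L : T -> {set C}) :
  {in U, forall u, 0 < #|L u|} -> exists b : T -> C, {in U, forall u, b u \in L u}.
Proof.
move=> L0; exists (fun u => odflt x0 [pick x in L u]) => u uU.
case: pickP => [//|none] /=; have /card_gt0P[x] := L0 u uU.
by rewrite none.
Qed.

(** The colours [B] towards [v] are fixed first. Each outward list keeps at least
    [t + 1 - degree e v] colours outside [B], hence at least [degree e v], and a greedy choice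
    succeeds. *)
Lemma no_low_degree e v k : critical C M t e -> 2 * k <= t.+1 ->
  0 < degree e v -> k < degree e v.
Proof.
move=> crit kt dv; rewrite ltnNge; apply/negP => dvk.
have [_ _ dM _ _] := crit.
have [F [K [KM FK no_ab]]] := critical_lists card_C crit (v := v) ltac:(lia).
have /card_gt0P[w0 w0N] := dv.
have /card_gt0P[x0 _] : 0 < #|K w0| by have := KM w0 w0N; have := dM w0; nat_arith.
have [|b bK] := @choose_colors x0 (nbrs e v) K.
  by move=> w /KM; have := dM w; nat_arith.
pose B := b @: nbrs e v.
have Bk : #|B| <= degree e v by apply: leq_imset_card.
have [|a atr] := @transversal_large _ _ x0 (nbrs e v) (fun w => F w :\: B).
  move=> w wN; have := outward_list_remains card_C (FK w wN) (dM w) (bK w wN) (imset_f b wN).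
  by rewrite -/B /degree -/(nbrs e v) in Bk dvk *; nat_arith.
have [|u [w [uN wN ab]]] := no_ab a b _ bK.
  by have [aF a_inj] := atr; split=> // w /aF; rewrite inE => /andP[].
by have := atr.1 u uN; rewrite inE ab imset_f.
Qed.

(** Once the colours towards [v] are fixed, every outward list may be one colour short. A neighbour
    [w] of degree below [M] has two choices [p] and [q] for its arc towards [v], and this freedom
    always yields a transversal. *)
Lemma full_degree_neighbors e v w : critical C M t e -> 2 <= degree e v <= t ->
  2 * degree e v <= t.+2 -> e v w -> degree e w = M.
Proof.
move=> crit /andP[dv2 dvt] dvt2 vw; have [_ _ dM _ _] := crit.
apply: NNPP => dwM; have {dwM} dw : degree e w < M by have := dM w; nat_arith.
have [F [K [KM FK no_ab]]] := critical_lists card_C crit (v := v) ltac:(lia).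
pose N := nbrs e v; have wN : w \in N by rewrite inE.
have dvN : degree e v = #|N| by [].
have [p [q [pK qK pq]]] : exists p q, [/\ p \in K w, q \in K w & p != q].
  have /card_gt1P[p [q [? ? ?]]] : 1 < #|K w| by have := KM w wN; nat_arith.
  by exists p, q.
have [|b0 b0K] := @choose_colors p N K; first by move=> x /KM; have := dM x; nat_arith.
pose R := b0 @: (N :\ w).
have NwE := cardsD1 w N; rewrite wN in NwE.
have Rk : #|R| < #|N| by rewrite NwE add1n ltnS leq_imset_card.
pose b r x := if x == w then r else b0 x.
have bE r : b r @: N \subset r |: R.
  apply/subsetP => y /imsetP[x xN ->]; rewrite /b.
  have [_|xw] := eqVneq x w; first by rewrite !inE eqxx.
  by rewrite inE; apply/orP; right; apply: imset_f; rewrite inE xN andbT inE.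
have bK r : r \in K w -> {in N, forall x, b r x \in K x}.
  by move=> rK x xN; rewrite /b; have [->|_] := eqVneq x w; [|apply: b0K].
have bw r : b r w = r by rewrite /b eqxx.
(* Every transversal avoiding the colours towards [v] extends the colouring. *)
have no_tr r a (B : {set C}) : r \in K w -> r |: R \subset B ->
    ~ transversal_of N (fun x => F x :\: B) a.
  move=> rK rB [aF a_inj]; have [|u [x [uN xN ab]]] := no_ab a (b r) _ (bK r rK).
    by split=> // x /aF; rewrite inE => /andP[].
  have := aF u uN; rewrite inE ab (subsetP rB) //.
  by apply: (subsetP (bE r)); apply: imset_f.
have remain r : r \in K w -> {in N, forall x, t < #|F x :\: (r |: R)| + #|r |: R|}.
  move=> rK x xN; apply: (outward_list_remains card_C (FK x xN) (dM x) (bK r rK x xN)).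
  by apply: (subsetP (bE r)); apply: imset_f.
have rR_card r : #|r |: R| <= #|N| by rewrite cardsU1; case: (_ \notin _); nat_arith.
(* If [r] were in [R], fewer than [#|N|] colours would be forbidden and no list would be short. *)
have not_R r : r \in K w -> r \notin R.
  move=> rK; apply/negP => rR.
  have [|a /(no_tr r a _ rK (subxx _))] // := @transversal_large _ _ p N (fun x => F x :\: (r |: R)).
  by move=> x /(remain r rK); rewrite (setUidPr _) ?sub1set //; nat_arith.
have almost r : r \in K w -> {in N, forall x, #|N| <= #|F x :\: (r |: R)|.+1}.
  by move=> rK x /(remain r rK); have := rR_card r; nat_arith.
have /card_gt0P[u] : 0 < #|N :\ w| by nat_arith.
rewrite !inE => /andP[uw vu]; have uN : u \in N by rewrite inE.
(* If [r] were missing from [F u], forbidding it would cost nothing at [u], which could then be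
   served last. *)
have in_Fu r : r \in K w -> r \in F u.
  move=> rK; apply: contraT => rF.
  have [|a /(no_tr r a _ rK (subxx _))] // :=
    @transversal_last _ _ p N (fun x => F x :\: (r |: R)) u uN (almost r rK).
  have -> : F u :\: (r |: R) = F u :\: R.
    apply/setP => y; rewrite !inE negb_or.
    by have [->|//] := eqVneq y r; rewrite (negPf rF) !andbF.
  have b0R : b0 u \in R by rewrite imset_f // !inE uw.
  by have := outward_list_remains card_C (FK u uN) (dM u) (b0K u uN) b0R; nat_arith.
(* If [F w] and [K w] are disjoint, [q] is available at [u] but not at [w]; otherwise [F w] is long
   enough for [w] to be served last. *)
have [dis|Fw] := FK w wN.
  have [||a /(no_tr p a _ pK (subxx _))] // :=
    @transversal_distinct _ _ p N (fun x => F x :\: (p |: R)) u w q uN wN (almost p pK).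
  - by rewrite !inE negb_or eq_sym pq not_R // in_Fu.
  - by rewrite inE (disjointFl dis.1 qK) andbF.
have [|a /(no_tr p a _ pK (subxx _))] // :=
  @transversal_last _ _ p N (fun x => F x :\: (p |: R)) w wN (almost p pK).
by have := card_setD_leq (F w) (p |: R); have := rR_card p; nat_arith.
Qed.

(** Degrees at most [t] make the cap automatic. The arc from [v] to [u] avoids at most
    [2 * (d - 1) + (k - 1)] colours, and then the reverse arc at most
    [2 * (k - 1) + (d - 1) + 1]. *)
Lemma no_light_edge e u v k d : critical C M t e -> e u v ->
  degree e u <= k <= t -> degree e v <= d <= t ->
  2 * d + k < #|C| + 3 -> 2 * k + d < #|C| + 2 -> False.
Proof.
move=> crit uv /andP[duk kt] /andP[dvd dt] dkC kdC.
have [e_sym e_irr _ no_col _] := crit.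
have vU : v \in [set v] by rewrite inE.
have Uu : [set v] \subset nbrs e u by rewrite sub1set inE.
have [c c_col] := critical_cut crit Uu vU.
have du := degree_cut_center Uu; have dv := degree_cut_leaf e_sym e_irr Uu vU.
rewrite cards1 in du; set e' := cut_star e u [set v] in c_col du dv.
have ou := card_out_colors e' c u; have iu := card_in_colors e' c u.
have ov := card_out_colors e' c v; have iv := card_in_colors e' c v.
have [|y _ yP] := @exists_notin C setT
    (out_colors e' c v :|: in_colors e' c v :|: out_colors e' c u).
  have := card_setU_leq (out_colors e' c v :|: in_colors e' c v) (out_colors e' c u).
  have := card_setU_leq (out_colors e' c v) (in_colors e' c v).
  by rewrite cardsT; nat_arith.
have [|x _ xP] := @exists_notin C setT
    (y |: (out_colors e' c u :|: in_colors e' c u :|: out_colors e' c v)).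
  have := card_setU_leq (out_colors e' c u :|: in_colors e' c u) (out_colors e' c v).
  have := card_setU_leq (out_colors e' c u) (in_colors e' c u).
  by rewrite cardsT cardsU1; case: (y \notin _); nat_arith.
move: yP xP; rewrite !inE !negb_or => /andP[/andP[y1 y2] y3] /and3P[xy /andP[x1 x2] x3].
apply: no_col; exists (recolor_star c u [set v] (fun=> x) (fun=> y)).
apply: recolor_starP; rewrite // -/e'.
- by move=> w; rewrite inE => /eqP->.
- by move=> w1 w2; rewrite !inE => /eqP-> /eqP->.
- by move=> w; rewrite inE => /eqP->.
- have := card_setU_leq (in_colors e' c u) ((fun=> y) @: [set v]).
  by rewrite imset_set1 cards1; nat_arith.
- move=> w; rewrite inE => /eqP->.
  by rewrite cardsU1; case: (_ \notin _); nat_arith.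
Qed.

(** At most one edge at [v] survives the removal of the star. A set of at most [h] colours meeting
    the lists of all leaves serves the arcs towards [v], so at most [h + 1 <= t] colours enter [v];
    the arcs leaving [v] are then coloured greedily. *)
Lemma no_light_star e v U k h r : critical C M t e -> U \subset nbrs e v ->
  degree e v <= #|U|.+1 -> {in U, forall u, degree e u <= k} -> 0 < #|U| ->
  k <= t -> h < t -> h + k + 1 + #|U| <= #|C| ->
  r * (2 * k.-1) < r.-1 * #|C|.-1 ->
  iter h (fun p => p - (p %/ r).+1) #|U| = 0 -> False.
Proof.
move=> crit Uv dv dU U0 kt ht hkC rkC hitU.
have [e_sym e_irr _ no_col _] := crit.
have /card_gt0P[u0 u0U] := U0.
have [c c_col] := critical_cut crit Uv u0U.
have dv' := degree_cut_center Uv; set e' := cut_star e v U in c_col dv'.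
have ov := card_out_colors e' c v; have iv := card_in_colors e' c v.
have du' u : u \in U -> degree e' u < k.
  by move=> uU; apply: leq_trans (dU u uU); apply: degree_cut_leaf.
pose L u := ~: out_colors e' c v :\: (out_colors e' c u :|: in_colors e' c u).
have X1 := cardsC (out_colors e' c v).
(* A list omits at most [2 * k.-1] of the colours not leaving [v], of which there are at least
   [#|C|.-1]; so it contains more than one in [r] of them. *)
have [| |H Hh HP] := @hitting_set _ _ r h U L (~: out_colors e' c v) _ _ hitU.
- by move=> u _; apply: subsetDl.
- move=> u uU; have := card_setD_leq (~: out_colors e' c v) (out_colors e' c u :|: in_colors e' c u).
  rewrite -/(L u); have := card_setU_leq (out_colors e' c u) (in_colors e' c u).
  have := card_out_colors e' c u; have := card_in_colors e' c u; have := du' u uU.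
  set X := #|~: _| in X1 *; set y := #|L u| => h1 h2 h3 h4 h5.
  have h6 : X <= y + 2 * k.-1 by nat_arith.
  have h7 : #|C|.-1 <= X by nat_arith.
  by case: r rkC {hitU} => // r rkC; nia.
have [k0 _ _] := HP u0 u0U.
have [|b bP] := @choose_colors k0 U (fun u => L u :&: H).
  by move=> u uU; have [x xL xH] := HP u uU; apply/card_gt0P; exists x; rewrite inE xL.
have bH : b @: U \subset H.
  by apply/subsetP => _ /imsetP[u uU ->]; have := bP u uU; rewrite inE => /andP[].
have v_cap : #|in_colors e' c v :|: b @: U| <= h.+1.
  have := card_setU_leq (in_colors e' c v) (b @: U).
  by have := subset_leq_card bH; nat_arith.
pose I := out_colors e' c v :|: (in_colors e' c v :|: b @: U).
have [|a [aP a_inj]] := @transversal_large _ _ k0 U (fun u => ~: (I :|: out_colors e' c u)).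
  move=> u uU; have := cardsC (I :|: out_colors e' c u).
  have := card_setU_leq I (out_colors e' c u).
  have := card_setU_leq (out_colors e' c v) (in_colors e' c v :|: b @: U).
  by have := card_out_colors e' c u; have := du' u uU; rewrite -/I; nat_arith.
have {}aP u : u \in U -> [/\ a u \notin out_colors e' c v,
   a u \notin in_colors e' c v, a u \notin b @: U & a u \notin out_colors e' c u].
  move=> /aP; rewrite in_setC in_setU [in X in X || _]in_setU [in X in _ || X || _]in_setU.
  by rewrite !negb_or => /andP[/and3P[-> -> ->] ->].
apply: no_col; exists (recolor_star c v U a b).
apply: recolor_starP; rewrite // -/e'.
- by move=> u /aP[].
- move=> u w /aP[_ _ au _] wU; apply: contraNneq au => ->; exact: imset_f.
- move=> u /bP; rewrite !inE => /andP[/andP[+ ->] _].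
  by rewrite negb_or => /andP[-> ->].
- by apply: leq_trans v_cap _.
- move=> u uU; have := card_in_colors e' c u; have := du' u uU.
  by rewrite cardsU1; case: (_ \notin _); nat_arith.
Qed.

(** [K w1] has at least four colours, so the arc from [w1] to [v] can be coloured after the three
    outward arcs. These then avoid just one colour [p] of [K w2] and one colour [r] of [K w3], with
    [w3] the third neighbour. If [w2] had degree below [M], two choices for [p] would give a
    transversal. *)
Lemma full_degree_other_neighbors e v w1 w2 : critical C M t e -> t = 3 -> 7 <= M ->
  degree e v = 3 -> e v w1 -> degree e w1 <= 4 -> e v w2 -> w2 != w1 ->
  degree e w2 = M.
Proof.
move=> crit t3 M7 dv vw1 dw1 vw2 w21; have [_ _ dM _ _] := crit.
apply: NNPP => dwM; have {dwM} dw2 : degree e w2 < M by have := dM w2; nat_arith.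
have [F [K [KM FK no_ab]]] := critical_lists card_C crit (v := v) ltac:(lia).
have [w3 /and3P[w31 w32 vw3]] : exists w3, [&& w3 != w1, w3 != w2 & e v w3].
  have [|w3 w3N] := @exists_notin _ (nbrs e v) [set w1; w2].
    by rewrite cards2 -/(degree e v) dv; case: (_ != _).
  by rewrite !inE negb_or => /andP[? ?]; exists w3; rewrite inE in w3N; apply/and3P.
have NE : nbrs e v = [set w1; w2; w3].
  apply/esym/eqP; rewrite eqEcard; apply/andP; split.
    by apply/subsetP => x; rewrite !inE => /orP[/orP[]|] /eqP->.
  by rewrite -/(degree e v) dv setUC !cardsU1 cards1 !inE negb_or w31 w32 eq_sym w21.
have [w1N w2N w3N] : [/\ w1 \in nbrs e v, w2 \in nbrs e v & w3 \in nbrs e v].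
  by rewrite !inE.
have /card_gt0P[r rK] : 0 < #|K w3| by have := KM w3 w3N; have := dM w3; nat_arith.
have fail p x1 x2 x3 : p \in K w2 ->
    x1 \in F w1 -> x2 \in F w2 -> x3 \in F w3 ->
    {in [:: x1; x2; x3], forall x, x \notin [set p; r]} -> uniq [:: x1; x2; x3] -> False.
  move=> pK x1F x2F x3F xpr xu.
  have [|q qK qx] := @exists_notin _ (K w1) [set x1; x2; x3].
    have := KM w1 w1N; rewrite setUC !cardsU1 cards1.
    by case: (_ \notin _); case: (_ \notin _); nat_arith.
  pose f (y1 y2 y3 : C) x := if x == w1 then y1 else if x == w2 then y2 else y3.
  have f1 y1 y2 y3 : f y1 y2 y3 w1 = y1 by rewrite /f eqxx.
  have f2 y1 y2 y3 : f y1 y2 y3 w2 = y2 by rewrite /f (negPf w21) eqxx.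
  have f3 y1 y2 y3 : f y1 y2 y3 w3 = y3 by rewrite /f (negPf w31) (negPf w32).
  have NP (P : T -> Prop) : P w1 -> P w2 -> P w3 -> {in nbrs e v, forall x, P x}.
    by move=> ? ? ? x; rewrite NE !inE => /orP[/orP[]|] /eqP->.
  have [| |u [w [uN wN]]] := no_ab (f x1 x2 x3) (f q p r).
  - split; first by apply: (NP (fun x => f x1 x2 x3 x \in F x)); rewrite ?f1 ?f2 ?f3.
    move: xu; rewrite /= !inE negb_or andbT => /andP[/andP[x12 x13] x23].
    move=> w w'; rewrite NE !inE => /orP[/orP[]|] /eqP-> /orP[/orP[]|] /eqP->;
      by rewrite ?f1 ?f2 ?f3 // => eq_x; move: x12 x13 x23; rewrite eq_x eqxx ?andbF.
  - by apply: (NP (fun x => f q p r x \in K x)); rewrite ?f1 ?f2 ?f3.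
  apply/eqP; have : f x1 x2 x3 u \in [:: x1; x2; x3].
    move: u uN; apply: (NP (fun u => f x1 x2 x3 u \in [:: x1; x2; x3]));
      by rewrite ?f1 ?f2 ?f3 !inE eqxx ?orbT.
  move: (f _ _ _ u) => x xx; have := xpr x xx; rewrite !inE negb_or => /andP[xp xr].
  move: w wN; apply: (NP (fun w => x != f q p r w)); rewrite ?f1 ?f2 ?f3 //.
  by apply: contraNneq qx => <-; move: xx; rewrite !inE orbA.
have card2 p : #|[set p; r]| <= 2 by rewrite cards2; case: (_ != _).
have S3 p : 1 < #|F w3 :\: [set p; r]|.
  have := outward_list_remains card_C (FK w3 w3N) (dM w3) rK (set22 p r).
  by have := card2 p; nat_arith.
have S2 p : p \in K w2 -> 1 < #|F w2 :\: [set p; r]|.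
  move=> pK; have := outward_list_remains card_C (FK w2 w2N) (dM w2) pK (set21 p r).
  by have := card2 p; nat_arith.
have S1 p : 0 < #|F w1 :\: [set p; r]|.
  have := card_setD_leq (F w1) [set p; r]; have := card2 p.
  by case: (FK w1 w1N) => [[_]|]; nat_arith.
have failS p x1 x2 x3 : p \in K w2 -> x1 \in F w1 :\: [set p; r] ->
    x2 \in F w2 :\: [set p; r] -> x3 \in F w3 :\: [set p; r] ->
    uniq [:: x1; x2; x3] -> False.
  move=> pK; rewrite ![_ \in _ :\: _]inE => /andP[n1 x1F] /andP[n2 x2F] /andP[n3 x3F].
  apply: (fail p) => // x; rewrite !(inE, in_cons) => /or3P[] /eqP->; by rewrite ?inE in n1 n2 n3.
have S3_small p : p \in K w2 -> #|F w3 :\: [set p; r]| <= 2.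
  move=> pK; rewrite leqNgt; apply/negP => big.
  have /card_gt0P[x1 x1S] := S1 p.
  have [|x2 x2S x21] := @exists_notin _ (F w2 :\: [set p; r]) [set x1].
    by rewrite cards1 S2.
  have [|x3 x3S x312] := @exists_notin _ (F w3 :\: [set p; r]) [set x1; x2].
    by rewrite cards2; case: (_ != _); nat_arith.
  apply: (failS p x1 x2 x3) => //; move: x21 x312; rewrite /= !inE !negb_or.
  by rewrite ![_ == x1]eq_sym [x3 == _]eq_sym => -> /andP[-> ->].
have S2_small p : p \in K w2 -> #|F w2 :\: [set p; r]| <= 2.
  move=> pK; rewrite leqNgt; apply/negP => big.
  have /card_gt0P[x1 x1S] := S1 p.
  have [|x3 x3S x31] := @exists_notin _ (F w3 :\: [set p; r]) [set x1].
    by rewrite cards1 S3.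
  have [|x2 x2S x213] := @exists_notin _ (F w2 :\: [set p; r]) [set x1; x3].
    by rewrite cards2; case: (_ != _); nat_arith.
  apply: (failS p x1 x2 x3) => //; move: x31 x213; rewrite /= !inE !negb_or.
  by rewrite ![_ == x1]eq_sym => -> /andP[-> ->].
have /card_gt1P[p [q [pK qK pq]]] : 1 < #|K w2| by have := KM w2 w2N; nat_arith.
have neq_r p' : p' \in K w2 -> p' != r.
  move=> pK'; apply/eqP => pr; have := S2_small p' pK'.
  have := outward_list_remains card_C (FK w2 w2N) (dM w2) pK' (set21 p' r).
  by rewrite pr setUid cards1; nat_arith.
have in_F3 p' : p' \in K w2 -> p' \in F w3.
  move=> pK'; apply: contraT => pF; have := S3_small p' pK'.
  have -> : F w3 :\: [set p'; r] = F w3 :\: [set r].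
    apply/setP => y; rewrite !inE negb_or.
    by have [->|//] := eqVneq y p'; rewrite (negPf pF) !andbF.
  have := outward_list_remains card_C (FK w3 w3N) (dM w3) rK (set11 r).
  by rewrite cards1; nat_arith.
have qS3 : q \in F w3 :\: [set p; r].
  by rewrite !inE in_F3 // negb_or eq_sym pq neq_r.
have qF2 : q \notin F w2.
  case: (FK w2 w2N) => [[dis _]|big]; first by rewrite (disjointFl dis qK).
  by have := S2_small p pK; have := card_setD_leq (F w2) [set p; r]; have := card2 p; nat_arith.
have /card_gt0P[x1 x1S] := S1 p.
have qx x : x \in F w2 :\: [set p; r] -> q != x.
  by apply: contraTneq => <-; rewrite !inE (negPf qF2) !andbF.
(* The colour [q] is available at [w3] but not at [w2]: it serves [w3] unless [w1] takes it, and
   then [w1] does not compete with [w2]. *)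
have [x1q|x1q] := eqVneq x1 q; last first.
  have [|x2 x2S x21] := @exists_notin _ (F w2 :\: [set p; r]) [set x1].
    by rewrite cards1 S2.
  apply: (failS p x1 x2 q) => //; move: x21; rewrite /= !inE negb_or x1q andbT.
  by rewrite eq_sym => ->; rewrite eq_sym qx.
have [|x3 x3S x31] := @exists_notin _ (F w3 :\: [set p; r]) [set x1].
  by rewrite cards1 S3.
have [|x2 x2S x23] := @exists_notin _ (F w2 :\: [set p; r]) [set x3].
  by rewrite cards1 S2.
apply: (failS p x1 x2 x3) => //; move: x31 x23; rewrite /= !inE negb_or eq_sym => -> ->.
by rewrite x1q qx.
Qed.

End Configurations.

(** * Seven-vertices all of whose neighbours are light, with ten colours *)

Section HeavyVertex.

Variables (T C : finType).
Hypothesis card_C : #|C| = 10.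
Implicit Types (e : rel T) (c : T -> T -> C) (U B : {set T}) (a b : T -> C).

(* Seven lists of six colours left by two colours at most fail to have a
   transversal only if they coincide, that is, if all the sets [out_colors]
   are equal. *)
Lemma extend_heavy_star e v c u1 u2 : symmetric e -> irreflexive e ->
  degree e v = 7 -> {in nbrs e v, forall u, degree e u <= 3} ->
  colored_by 3 (cut_star e v (nbrs e v)) c ->
  u1 \in nbrs e v -> u2 \in nbrs e v ->
  out_colors (cut_star e v (nbrs e v)) c u1 !=
  out_colors (cut_star e v (nbrs e v)) c u2 ->
  colorable_by C 3 e.
Proof.
move=> e_sym e_irr dv dU c_col u1N u2N out12.
set N := nbrs e v in dU c_col u1N u2N out12 *.
set e' := cut_star e v N in c_col out12.
have [out0 in0] := isolated_center e v c; rewrite -/N -/e' in out0 in0.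
have N7 : #|N| = 7 by [].
have du u : u \in N -> degree e' u < 3.
  by move=> uN; apply: leq_trans (dU u uN); apply: degree_cut_leaf.
have out_le2 u : u \in N -> #|out_colors e' c u| <= 2.
  by move=> uN; have := card_out_colors e' c u; have := du u uN; nat_arith.
pose L u := ~: (out_colors e' c u :|: in_colors e' c u).
have L6 u : u \in N -> 6 <= #|L u|.
  move=> uN; have := cardsC (out_colors e' c u :|: in_colors e' c u).
  have := card_setU_leq (out_colors e' c u) (in_colors e' c u); have := du u uN.
  have := card_out_colors e' c u; have := card_in_colors e' c u.
  by rewrite card_C -/(L u); nat_arith.
have C0 : [set: C] != set0 by rewrite -card_gt0 cardsT card_C.
(* Seven lists of at least six among ten colours: some colour lies in five of them, and the at most
   two other lists have a common colour. *)
have [x1 x1P] := @popular_color T C N L setT 6 C0 (fun _ _ => subsetT _) L6.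
rewrite cardsT card_C N7 in x1P.
pose V := [set u in N | x1 \notin L u].
have V2 : #|V| <= 2.
  have : #|V| + #|[set u in N | x1 \in L u]| = #|N|.
    rewrite -(cardsID [set u | x1 \in L u] N) addnC; congr (_ + _); apply: eq_card => u.
      by rewrite !inE.
    by rewrite !inE andbC.
  by rewrite N7; nat_arith.
have [x2 x2P] : exists x2, {in V, forall u, x2 \in L u}.
  have [|x2 x2P] := @popular_color T C V L setT 6 C0 (fun _ _ => subsetT _).
    by move=> u; rewrite inE => /andP[/L6].
  exists x2 => u uV; rewrite cardsT card_C in x2P.
  have sub : [set u in V | x2 \in L u] \subset V.
    by apply/subsetP => w; rewrite inE => /andP[].
  have /eqP eqV : [set u in V | x2 \in L u] == V.
    by rewrite eqEcard sub; have := subset_leq_card sub; nat_arith.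
  by move: uV; rewrite -{1}eqV inE => /andP[].
pose b u := if x1 \in L u then x1 else x2.
have bL u : u \in N -> b u \in L u.
  by rewrite /b => uN; case: ifP => // /negbT x1L; apply: x2P; rewrite inE uN.
pose H := [set x1; x2].
have H2 : #|H| <= 2 by rewrite cards2; case: (_ != _).
have bH : b @: N \subset H.
  by apply/subsetP => _ /imsetP[u _ ->]; rewrite /b !inE; case: ifP; rewrite eqxx ?orbT.
pose S u := ~: (H :|: out_colors e' c u).
have S_card u : u \in N -> #|S u| + #|H| + #|out_colors e' c u| =
    10 + #|H :&: out_colors e' c u|.
  move=> uN; have := cardsC (H :|: out_colors e' c u).
  by have := cardsUI H (out_colors e' c u); rewrite card_C -/(S u); nat_arith.
have [a [aS a_inj]] : exists a, transversal_of N S a.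
  have S6 : {in N, forall u, #|N| <= #|S u|.+1}.
    by move=> u uN; have := S_card u uN; have := out_le2 u uN; nat_arith.
  have [/existsP[u /andP[uN S7]]|none] := boolP [exists u in N, 7 <= #|S u|].
    by apply: (@transversal_last _ _ x1 N S u) => //; rewrite N7.
  (* Without a list of seven colours, the colours leaving each leaf form a pair disjoint from [H]; a
     colour leaving [u2] but not [u1] is then available at [u1] and not at [u2]. *)
  have all6 u : u \in N -> [disjoint H & out_colors e' c u] /\ #|out_colors e' c u| = 2.
    move=> uN; have S7 : #|S u| < 7.
      rewrite ltnNge; apply: contra none => S7; apply/existsP; exists u.
      by rewrite uN.
    rewrite -setI_eq0 -cards_eq0; have := S_card u uN; have := out_le2 u uN.
    by split; last nat_arith; apply/eqP; nat_arith.
  have [dis1 card1] := all6 u1 u1N; have [dis2 card2] := all6 u2 u2N.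
  have : ~~ (out_colors e' c u2 \subset out_colors e' c u1).
    by apply: contra out12 => sub; rewrite eq_sym eqEcard sub card1 card2.
  case/subsetPn => y y2 y1.
  apply: (@transversal_distinct _ _ x1 N S u1 u2 y) => //.
    by rewrite in_setC in_setU (negPf y1) (disjointFl dis2 y2).
  by rewrite in_setC in_setU y2 orbT.
exists (recolor_star c v N a b); apply: recolor_starP; rewrite // -/e' ?out0 ?in0.
- by move=> u /aS; rewrite !inE !negb_or => /andP[_ ->].
- move=> u w uN wN; have := aS u uN; rewrite inE; apply: contraNneq => ->.
  by rewrite inE (subsetP bH) ?imset_f.
- by move=> u /bL; rewrite inE in_setU negb_or inE => /andP[-> ->].
- by rewrite set0U; apply: leq_trans (subset_leq_card bH) _; nat_arith.
- move=> u uN; have := card_in_colors e' c u; have := du u uN.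
  by rewrite cardsU1; case: (_ \notin _); nat_arith.
Qed.

(** The lists belong to two neighbours [z] and [w] of a vertex [u]: the arcs from [u] to [z] and [w]
    get [y] and [p], the reverse arcs [s] and [r]. As two values of [p] remain, the set of colours
    leaving [u] can be varied. *)
Lemma two_leaf_choices (Fz Fw Kz Kw : {set C}) dz dw :
  7 < #|Kz| + dz -> dz <= 4 -> 7 < #|Kw| + dw -> dw <= 7 ->
  ([disjoint Fz & Kz] /\ #|Fz| = 3) \/ 7 + 3 < #|Fz| + dz ->
  ([disjoint Fw & Kw] /\ #|Fw| = 3) \/ 7 + 3 < #|Fw| + dw ->
  exists r y (P : {set C}), [/\ r \in Kw, y \in Fz, y != r, 1 < #|P| &
    {in P, forall p, [/\ p \in Fw, p != r, p != y &
                         exists2 s, s \in Kz & s \notin [set y; p]]}].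
Proof.
move=> KzM dz4 KwM dw7 FKz FKw.
have /card_gt0P[r rK] : 0 < #|Kw| by nat_arith.
have Fw2 : 2 < #|Fw :\ r|.
  have := outward_list_remains (card_C : #|C| = 7 + 3) FKw dw7 rK (set11 r).
  by rewrite cards1; nat_arith.
have /card_gt0P[y] : 0 < #|Fz :\ r|.
  have := card_setD_leq Fz [set r]; rewrite cards1.
  by case: FKz => [[_]|]; nat_arith.
rewrite !inE => /andP[yr yF]; exists r, y, (Fw :\ r :\ y); split=> //.
  by have := cardsD1 y (Fw :\ r); case: (y \in _); nat_arith.
move=> p; rewrite !inE => /and3P[py pr pF]; split=> //.
by apply: exists_notin; rewrite cards2; case: (_ != _); nat_arith.
Qed.

(** The edges at [v] and at [u] are removed. Restoring those from [u] to [z] and [w] in two ways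
    gives different sets of colours leaving [u], while another leaf [u2] keeps its set. In one of
    the two ways these sets differ at [u] and [u2], and the star at [v] can be restored. *)
Lemma no_heavy_vertex e v u z : critical C 7 3 e -> degree e v = 7 ->
  {in nbrs e v, forall u, degree e u <= 3} ->
  e v u -> degree e u = 3 -> e u z -> degree e z <= 4 -> False.
Proof.
move=> crit dv dN vu du uz dz; have [e_sym e_irr dM no_col crit_sub] := crit.
pose N := nbrs e v; have uN : u \in N by rewrite inE.
have uv : e u v by rewrite e_sym.
have zv : z != v by apply: contraTneq dz => ->; rewrite dv.
have vu' : v != u by apply: contraTneq vu => ->; rewrite e_irr.
have uN' : v \notin N by rewrite inE e_irr.
have [w /and3P[wv wz uw]] : exists w, [&& w != v, w != z & e u w].
  have [|w wN] := @exists_notin _ (nbrs e u) [set v; z].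
    by rewrite cards2 -/(degree e u) du; case: (_ != _).
  by rewrite !inE negb_or => /andP[? ?]; exists w; rewrite inE in wN; apply/and3P.
have NuE : nbrs e u = [set v; z; w].
  apply/esym/eqP; rewrite eqEcard; apply/andP; split.
    by apply/subsetP => x; rewrite !inE => /orP[/orP[]|] /eqP->.
  by rewrite -/(degree e u) du setUC !cardsU1 cards1 !inE negb_or wv wz eq_sym zv.
pose e1 := cut_star e v N.
have e1_sym : symmetric e1 by apply: cut_star_sym.
have e1_irr : irreflexive e1 by move=> x; rewrite /e1 /cut_star e_irr.
have e1_sub : subrel e1 e by apply: cut_star_sub.
pose W := nbrs e1 u.
have WE : W = [set z; w].
  apply/setP => x; have := erefl (x \in nbrs e u); rewrite {2}NuE !inE /e1 /cut_star.
  rewrite (eq_sym u v) (negPf vu') uN andbT /= => ->.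
  have [->|xv] := eqVneq x v; rewrite ?andbF ?andbT //.
  by rewrite !(eq_sym v) (negPf zv) (negPf wv).
have [zW wW] : z \in W /\ w \in W by rewrite WE !inE !eqxx orbT.
have uW : u \notin W by rewrite inE e1_irr.
pose e2 := cut_star e1 u W.
have [c c_col] : colorable_by C 3 e2.
  apply: crit_sub; first exact: cut_star_sym.
    by move=> x y /cut_star_sub /e1_sub.
  by exists v, u; rewrite vu /e2 /e1 /cut_star eqxx uN andbF.
have e1_deg x : degree e1 x <= degree e x by apply: degree_sub.
have e1_M x : degree e1 x <= 7 by apply: leq_trans (e1_deg x) (dM x).
pose F := outward_list 3 e2 c; pose K := inward_list e2 c.
have KM := card_inward_list (card_C : #|C| = 7 + 3) e1_sym e1_irr c_col.
have FK := outward_list_dichotomy (card_C : #|C| = 7 + 3) e1_sym e1_irr c_col.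
rewrite -/W -/e2 -/K in KM FK; rewrite -/F in FK.
have dz1 : degree e1 z <= 4 by apply: leq_trans (e1_deg z) dz.
have [r [y [P [rK yF yr P1 PP]]]] :=
  two_leaf_choices (KM z zW) dz1 (KM w wW) (e1_M w) (FK z zW) (FK w wW).
have /card_gt1P[p [q [pP qP pq]]] := P1.
(* Two colourings that differ around [u], but not around other leaves of the star. *)
have ext p' : p' \in P -> exists c',
    [/\ colored_by 3 e1 c', out_colors e1 c' u = [set y; p'] &
        forall x, x != u -> x \notin W -> out_colors e1 c' x = out_colors e2 c x].
  move=> /PP[pF pr py [s sK]].
  rewrite !inE negb_or => /andP[sy sp].
  pose a x := if x == z then y else p'; pose b x := if x == z then s else r.
  have az : a z = y by rewrite /a eqxx.
  have aw : a w = p' by rewrite /a (negPf wz).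
  have WP (Q : T -> Prop) : Q z -> Q w -> {in W, forall x, Q x}.
    by move=> ? ? x; rewrite WE !inE => /orP[] /eqP->.
  exists (recolor_star c u W a b); split.
  - apply: (recolor_vertexP (card_C : #|C| = 7 + 3)) => //.
    + by apply: (WP (fun x => a x \in F x)); rewrite ?az ?aw.
    + by apply: (WP (fun x => b x \in K x)); rewrite /b ?eqxx ?(negPf wz).
    + move=> x1 x2; rewrite -/W WE !inE => /orP[] /eqP-> /orP[] /eqP->; rewrite ?az ?aw //.
        by move=> yp; rewrite yp eqxx in py.
      by move=> yp; rewrite yp eqxx in py.
    + move=> x1 x2; rewrite -/W WE !inE => /orP[] /eqP-> /orP[] /eqP->;
        rewrite ?az ?aw /b ?eqxx ?(negPf wz) //.
        by rewrite eq_sym.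
      by rewrite eq_sym.
    + by apply: leq_trans (leq_imset_card _ _) _; rewrite -/W WE cards2; case: (_ != _).
  - have rE x : x \in W -> recolor_star c u W a b u x = a x.
      by rewrite /recolor_star eqxx => ->.
    by rewrite /out_colors -/W {2}WE imsetU1 imset_set1 !rE // az aw.
  - move=> x xu xW; exact: out_colors_recolor.
have [u2 u2N] : exists2 u2, u2 \in N & u2 \notin [set u; z; w].
  apply: exists_notin; rewrite -/N -/(degree e v) dv setUC !cardsU1 cards1.
  by case: (_ \notin _); case: (_ \notin _).
rewrite !inE !negb_or => /andP[/andP[u2u u2z] u2w].
have u2W : u2 \notin W by rewrite WE !inE negb_or u2z.
have [p' p'P out_neq] : exists2 p', p' \in P & [set y; p'] != out_colors e2 c u2.
  have [eq_p|] := eqVneq [set y; p] (out_colors e2 c u2); last by exists p.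
  exists q => //; rewrite -eq_p; apply/eqP => /setP/(_ p); rewrite !inE eqxx orbT.
  by have [_ _ /negPf->] := PP p pP; rewrite (negPf pq).
have [c' [c'_col out_u out_x]] := ext p' p'P.
apply: no_col; apply: (@extend_heavy_star e v c' u u2) => //.
by rewrite -/e1 out_u out_x.
Qed.

End HeavyVertex.

(** * Twice the maximum degree *)

Section DoubleDegree.

Variables (T : finType) (e : rel T) (D : nat).
Hypotheses (e_sym : symmetric e) (e_irr : irreflexive e).
Hypotheses (D0 : 0 < D) (eD : forall x, degree e x <= D).

Implicit Types (p : {ffun T * T -> 'I_D}).

Definition port_labelling p :=
  [forall x, forall y, forall z,
     [&& e x y, e x z & p (x, y) == p (x, z)] ==> (y == z)].

Definition mutual_pairs p : {set T * T} :=
  [set q | e q.1 q.2 && (p q == p (q.2, q.1))].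

Lemma port_labellingP p :
  reflect (forall x y z, e x y -> e x z -> p (x, y) = p (x, z) -> y = z)
          (port_labelling p).
Proof.
apply: (iffP forallP) => [lab x y z xy xz eq_p|lab x].
  have /forallP/(_ y)/forallP/(_ z) := lab x.
  by rewrite xy xz eq_p eqxx => /eqP.
apply/forallP => y; apply/forallP => z; apply/implyP => /and3P[xy xz /eqP eq_p].
by apply/eqP; apply: lab eq_p.
Qed.

Lemma ex_port_labelling : exists p, port_labelling p.
Proof.
have k0 : 'I_D := Ordinal D0.
(* An arc is labelled by the rank of its head among the neighbours of its tail; the default [k0] can
   occur only at pairs that are not arcs. *)
exists [ffun q => insubd k0 (index q.2 (enum (nbrs e q.1)))].
apply/port_labellingP => x y z xy xz; rewrite !ffunE /= => eq_p.
have small w : e x w -> index w (enum (nbrs e x)) < D.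
  by move=> xw; apply: leq_trans (eD x); rewrite /degree cardE index_mem mem_enum inE.
have := congr1 val eq_p; rewrite !val_insubd !small // => eq_i.
have mem_x w : e x w -> w \in enum (nbrs e x) by rewrite mem_enum inE.
by rewrite -(nth_index y (mem_x y xy)) eq_i nth_index ?mem_x.
Qed.

(* Otherwise exchanging the labels of [(x, y)] and [(x, z)] creates a mutual
   pair without destroying any. *)
Lemma max_mutual_pairs : exists2 p, port_labelling p &
  forall x y z, e y x -> e x z -> p (y, x) = p (x, z) -> p (z, x) = p (x, z).
Proof.
have [p0 lab0] := ex_port_labelling.
have [p lab pmax] := arg_maxnP (fun p => #|mutual_pairs p|) lab0.
exists p => // x y z yx xz eq_k; have /port_labellingP inj_p := lab.
have [yz|yz] := eqVneq y z; first by rewrite -yz eq_k -yz.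
apply/eqP; apply: contraT => zx_k.
have xy : e x y by rewrite e_sym.
have [xNy xNz] : x != y /\ x != z.
  by split; [apply: contraTneq xy|apply: contraTneq xz] => ->; rewrite e_irr.
have jk : p (x, y) != p (x, z).
  by apply: contraNneq yz => /(inj_p _ _ _ xy xz) ->.
pose p' := [ffun q => if q == (x, z) then p (x, y)
                      else if q == (x, y) then p (x, z) else p q].
have p'z : p' (x, z) = p (x, y) by rewrite ffunE eqxx.
have p'y : p' (x, y) = p (x, z) by rewrite ffunE xpair_eqE eqxx (negPf yz) eqxx.
have p'E q : q != (x, z) -> q != (x, y) -> p' q = p q.
  by move=> /negPf q1 /negPf q2; rewrite ffunE q1 q2.
have p'x u w : u != x -> p' (u, w) = p (u, w).
  by move=> ux; apply: p'E; rewrite xpair_eqE (negPf ux).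
have lab' : port_labelling p'.
  apply/port_labellingP => u w1 w2 uw1 uw2.
  have [ux|ux] := eqVneq u x; last by rewrite !p'x //; apply: inj_p.
  subst u; pose s w := if w == z then y else if w == y then z else w.
  have sE w : p' (x, w) = p (x, s w).
    rewrite /s; have [->|wz] := eqVneq w z; first by rewrite p'z.
    have [->|wy] := eqVneq w y; first by rewrite p'y.
    by rewrite p'E // xpair_eqE eqxx.
  have sK w : s (s w) = w.
    rewrite /s; have [->|wz] := eqVneq w z; first by rewrite (negPf yz) eqxx.
    by have [->|wy] := eqVneq w y; rewrite ?eqxx // (negPf wz) (negPf wy).
  have es w : e x w -> e x (s w).
    by rewrite /s; case: eqVneq => // _; case: eqVneq.
  by rewrite !sE => /inj_p eq_s; rewrite -[w1]sK eq_s ?sK // es.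
have := pmax p' lab'; rewrite /= leqNgt => /negP[].
apply/proper_card/properP; split; last first.
  exists (x, y); rewrite inE /= xy /=; last by rewrite eq_k.
  by rewrite p'y p'x ?eq_k // eq_sym.
(* No mutual pair is lost, since neither [(x, y)] nor [(x, z)] nor a reverse of these was mutual. *)
apply/subsetP => -[u w]; rewrite !inE /= => /andP[-> /= /eqP mut].
have [ux|ux] := eqVneq u x.
  subst u; have [wz|wz] := eqVneq w z; first by rewrite -wz -mut wz eqxx in zx_k.
  have [wy|wy] := eqVneq w y; first by rewrite -eq_k -wy mut eqxx in jk.
  rewrite p'E ?xpair_eqE ?(negPf wz) ?(negPf wy) ?andbF //.
  have [wx|wx] := eqVneq w x; first by rewrite wx p'E // xpair_eqE eqxx.
  by rewrite p'x ?mut.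
rewrite p'x //; have [wx|wx] := eqVneq w x; last by rewrite p'x ?mut.
subst w; have [uz|uz] := eqVneq u z; first by rewrite -uz mut eqxx in zx_k.
have [uy|uy] := eqVneq u y; first by rewrite -eq_k -uy mut eqxx in jk.
by rewrite p'E ?xpair_eqE ?(negPf uz) ?(negPf uy) ?andbF // mut.
Qed.

(** Of two consecutive arcs with equal labels, the second lies in a mutual pair. Either they are the
    two arcs of one edge, told apart by the order of its ends, or the first is not mutual and
    receives the bit opposite to that of the second. *)
Lemma double_degree_coloring : exists c : T -> T -> 'I_D * bool, arc_coloring e c.
Proof.
have [p /port_labellingP inj_p mut] := max_mutual_pairs.
pose below (x y : T) := enum_rank x < enum_rank y.
have belowC x y : x != y -> below y x = ~~ below x y.
  move=> xy; rewrite /below -leqNgt ltn_neqAle (inj_eq val_inj) (inj_eq enum_rank_inj).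
  by rewrite eq_sym xy.
pose g x y := if p (y, x) == p (x, y) then below x y
  else if [pick z | e y z && (p (y, z) == p (x, y))] is Some z then ~~ below y z
  else false.
exists (fun x y => (p (x, y), g x y)); split=> [x y z xy xz [eq_p _]|x y z xy yz].
  exact: inj_p eq_p.
apply/eqP => -[eq_p]; have mut_z := mut _ _ _ xy yz eq_p.
have yNz : y != z by apply: contraTneq yz => ->; rewrite e_irr.
rewrite {2}/g mut_z eqxx /g; case: ifPn => [/eqP eq_yx|_].
  have -> : x = z by apply: (inj_p y); rewrite // 1?e_sym // eq_yx eq_p.
  by rewrite belowC //; case: (below _ _).
case: pickP => [w /andP[yw /eqP eq_w]|/(_ z)]; last by rewrite yz eq_p eqxx.
have -> : w = z by apply: (inj_p y); rewrite // eq_w.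
by case: (below _ _).
Qed.

End DoubleDegree.

(** * From arcs to incidences *)

Section Incidences.

Variables (T C : finType) (e : rel T) (c : T -> T -> C).
Hypothesis e_sym : symmetric e.

Lemma incidence_arc (i : incidence e) :
  exists y, e (inc_vertex i) y && (inc_edge i == [set inc_vertex i; y]).
Proof.
case: i => -[x f] /= Pi; rewrite /inc_vertex /inc_edge /=.
move: Pi; rewrite /is_incidence => /andP[/imsetP[[u w]] /=].
rewrite inE /= => uw ->; rewrite !inE => /orP[] /eqP->.
  by exists w; rewrite uw eqxx.
by exists u; rewrite e_sym uw setUC eqxx.
Qed.

(** Adjacent incidences correspond to arcs with a common tail or to consecutive arcs, the two
    incidences of one edge being of the second kind. *)
Lemma incidence_chromatic_number_le N : arc_coloring e c -> #|C| <= N ->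
  incidence_chromatic_number e <= N.
Proof.
move=> [c1 c2] CN; rewrite /incidence_chromatic_number; case: ex_minnP => m _; apply.
pose y (i : incidence e) := xchoose (incidence_arc i).
have yP i : e (inc_vertex i) (y i) /\ inc_edge i = [set inc_vertex i; y i].
  by have /andP[-> /eqP] := xchooseP (incidence_arc i).
pose f (i : incidence e) := widen_ord CN (enum_rank (c (inc_vertex i) (y i))).
apply/existsP; exists [ffun i => f i]; apply/forallP => i; apply/forallP => j.
apply/implyP => /andP[ij adj_ij]; rewrite !ffunE.
suff : c (inc_vertex i) (y i) != c (inc_vertex j) (y j).
  by apply: contraNneq => /(congr1 val) /= /val_inj /enum_rank_inj ->.
have [ei fi] := yP i; have [ej fj] := yP j.
have [eq_v|neq_v] := eqVneq (inc_vertex i) (inc_vertex j).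
  apply: contraNneq ij; rewrite -eq_v in ej fj * => /(c1 _ _ _ ei ej) eq_y.
  by apply/eqP/val_inj; rewrite [val i]surjective_pairing [val j]surjective_pairing;
     congr pair; [|rewrite -/(inc_edge i) fi eq_y -fj].
have [vj|vi] : inc_vertex j = y i \/ inc_vertex i = y j.
- have mem : inc_vertex j \in inc_edge i \/ inc_vertex i \in inc_edge j.
    move: adj_ij; rewrite (negPf neq_v) /= => /or3P[/eqP->|/eqP<-|/eqP<-].
    + by left; rewrite fj !inE eqxx.
    + by left; rewrite !inE eqxx orbT.
    + by right; rewrite !inE eqxx.
  move: mem; rewrite fi fj !inE (negPf neq_v) eq_sym (negPf neq_v) /=.
  by case=> /eqP; [left|right].
- by rewrite vj; apply: c2 => //; rewrite -vj.
- by rewrite eq_sym vi; apply: c2 => //; rewrite -vi.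
Qed.

End Incidences.

(** * Discharging and the maximum average degree *)

Section Discharging.

Import Order.TTheory GRing.Theory Num.Theory.

Variables (T : finType) (e e' : rel T).
Hypotheses (e'_sym : symmetric e') (e'_irr : irreflexive e').
Hypothesis e'_sub : subrel e' e.

Lemma sum_degree_le : \sum_(x : T) degree e' x <= 2 * #|edges e'|.
Proof.
have -> : \sum_(x : T) degree e' x = \sum_(q : T * T | e' q.1 q.2) 1.
  rewrite (eq_bigr (fun x => \sum_(y | e' x y) 1)).
    by rewrite pair_big_dep.
  by move=> x _; rewrite sum1_card /degree; apply: eq_card => y; rewrite inE.
pose h (q : T * T) := [set q.1; q.2].
rewrite (partition_big h (mem (edges e'))) /=; last first.
  by move=> q eq; apply/imsetP; exists q; rewrite ?inE.
rewrite mulnC -sum_nat_const; apply: leq_sum => f /imsetP[[u w] uw ->].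
rewrite sum1_card; apply: (@leq_trans #|[set (u, w); (w, u)]|); last first.
  by rewrite cards2; case: (_ != _).
apply/subset_leq_card/subsetP => -[x y] /andP[/= xy /eqP eq_f].
have xNy : x != y by apply: contraTneq xy => ->; rewrite e'_irr.
have : x \in [set u; w] by rewrite /= in eq_f; rewrite -[[set u; w]]eq_f !inE eqxx.
have : y \in [set u; w] by rewrite /= in eq_f; rewrite -[[set u; w]]eq_f !inE eqxx orbT.
rewrite !inE !xpair_eqE => /orP[] /eqP yE /orP[] /eqP xE; subst x y;
  by rewrite ?eqxx ?orbT // in xNy *.
Qed.

(** A vertex [x] starts with [A] per incident edge and sends [r x y] to each neighbour [y], so the
    total is preserved. The vertices of positive degree and the edges of [e'] form a subgraph of
    [e], whose ratio is therefore at least [B / A]. *)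
Lemma mad_discharging (A B : nat) (r : T -> T -> nat) :
  0 < A -> (exists x y, e' x y) ->
  (forall x, 0 < degree e' x ->
     B + \sum_(y in nbrs e' x) r x y <=
     A * degree e' x + \sum_(y in nbrs e' x) r y x) ->
  (B%:R / A%:R <= mad e :> rat)%R.
Proof.
move=> A0 [x0 [y0 xy0]] charge.
pose S := [set x | 0 < degree e' x].
have S0 : 0 < #|S|.
  by apply/card_gt0P; exists x0; rewrite inE; apply/card_gt0P; exists y0; rewrite inE.
have flow : \sum_(x in S) \sum_(y in nbrs e' x) r x y =
            \sum_(x in S) \sum_(y in nbrs e' x) r y x.
  have ext (F : T -> T -> nat) : \sum_(x in S) \sum_(y in nbrs e' x) F x y =
      \sum_x \sum_(y | e' x y) F x y.
    rewrite [RHS](bigID (mem S)) /= [X in _ = _ + X]big1 ?addn0.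
      by apply: eq_bigr => x _; apply: eq_bigl => y; rewrite inE.
    move=> x; rewrite inE -eqn0Ngt cards_eq0 => /eqP xN; apply: big1 => y xy.
    by have := in_set0 y; rewrite -xN inE xy.
  rewrite !ext (exchange_big_dep xpredT) //=; apply: eq_bigr => x _.
  by apply: eq_bigl => y; rewrite e'_sym.
have total : B * #|S| <= A * (2 * #|edges e'|).
  apply: (@leq_trans (A * \sum_(x in S) degree e' x)); last first.
    rewrite leq_mul2l; apply/orP; right; apply: leq_trans sum_degree_le.
    by rewrite [leqRHS](bigID (mem S)) /= leq_addr.
  rewrite mulnC -sum_nat_const big_distrr /= -(leq_add2r (\sum_(x in S) \sum_(y in nbrs e' x) r x y)).
  rewrite {2}flow -!big_split /=; apply: leq_sum => x; rewrite inE.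
  exact: charge.
have sub_H : is_subgraph e (S, edges e').
  apply/and3P; split => /=; first by rewrite -card_gt0.
    apply/subsetP => f /imsetP[q]; rewrite inE => /e'_sub eq ->.
    by apply/imsetP; exists q; rewrite ?inE.
  apply/forallP => f; apply/implyP => /imsetP[[u w]]; rewrite inE /= => uw ->.
  apply/subsetP => x; rewrite !inE => /orP[] /eqP->; apply/card_gt0P.
    by exists w; rewrite inE.
  by exists u; rewrite inE e'_sym.
rewrite /mad; apply: le_trans (le_bigmax_cond _ _ sub_H) => /=.
rewrite ler_pdivrMr ?ltr0n // mulrAC ler_pdivlMr ?ltr0n //.
by rewrite -!natrM ler_nat mulnC [leqRHS]mulnC mulnC.
Qed.

End Discharging.

(** * Charges of critical graphs *)

Section Charges.

Variables (T C : finType) (M t : nat).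
Hypothesis card_C : #|C| = M + t.
Implicit Types (e : rel T) (V : {set T}) (F : T -> nat).

(** Induction on the number of arcs: a subgraph that is not colourable, while those with fewer arcs
    are, would be critical. *)
Lemma colorable_no_critical e : symmetric e -> irreflexive e ->
  (forall x, degree e x <= M) ->
  (forall e', subrel e' e -> critical C M t e' -> False) -> colorable_by C t e.
Proof.
move=> e_sym e_irr eM no_crit.
pose arcs (e' : rel T) := [set q : T * T | e' q.1 q.2].
suff main n e' : #|arcs e'| < n -> symmetric e' -> subrel e' e -> colorable_by C t e'.
  by apply: (main #|arcs e|.+1).
elim: n e' => [|n IHn] e' //; rewrite ltnS => arcs_n e'_sym sub.
apply: NNPP => no_col; apply: (no_crit e') => //; split=> //.
- by move=> x; apply: contraFF (e_irr x) => /sub.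
- by move=> x; apply: leq_trans (eM x); apply: degree_sub.
move=> e2 e2_sym sub2 [x [y /andP[xy nxy]]]; apply: IHn => //; last first.
  by move=> u v /sub2 /sub.
apply: leq_trans arcs_n; apply/proper_card/properP; split.
  by apply/subsetP => q; rewrite !inE => /sub2.
by exists (x, y); rewrite inE.
Qed.

Lemma critical_edge e : critical C M t e -> 0 < #|C| -> exists x y, e x y.
Proof.
move=> [_ _ _ no_col _] /card_gt0P[k _]; apply: NNPP => no_edge; apply: no_col.
have none x y : e x y -> False by move=> xy; apply: no_edge; exists x, y.
exists (fun _ _ => k); split; first by split=> x y z /none.
move=> x; apply: leq_trans (card_in_colors _ _ _) _.
suff -> : degree e x = 0 by []; apply/eqP; rewrite cards_eq0.
by apply/eqP/setP => y; rewrite !inE; apply/negP => /none.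
Qed.

Lemma few_light_neighbors e v n k h r : critical C M t e ->
  degree e v <= n.+1 -> 0 < n -> k <= t -> h < t -> h + k + 1 + n <= #|C| ->
  r * (2 * k.-1) < r.-1 * #|C|.-1 -> iter h (fun p => p - (p %/ r).+1) n = 0 ->
  #|[set u in nbrs e v | degree e u <= k]| < n.
Proof.
move=> crit dv n0 kt ht hkn rk hit; rewrite ltnNge; apply/negP => big.
set V := [set u in _ | _] in big.
pose U := [set u in take n (enum V)].
have U_V : U \subset V.
  by apply/subsetP => u; rewrite inE => /mem_take; rewrite mem_enum.
have Un : #|U| = n.
  by rewrite cardsE (card_uniqP _) ?take_uniq ?enum_uniq // size_takel -?cardE.
apply: (no_light_star card_C crit (v := v) (U := U) (k := k) (h := h) (r := r)); rewrite ?Un //.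
  by apply: subset_trans U_V _; apply/subsetP => u; rewrite !inE => /andP[].
by move=> u /(subsetP U_V); rewrite inE => /andP[].
Qed.

Lemma sum_le_const V F k : {in V, forall y, F y <= k} -> \sum_(y in V) F y <= k * #|V|.
Proof. by move=> Fk; rewrite mulnC -sum_nat_const; apply: leq_sum. Qed.

Lemma sum_ge_const V F k : {in V, forall y, k <= F y} -> k * #|V| <= \sum_(y in V) F y.
Proof. by move=> Fk; rewrite mulnC -sum_nat_const; apply: leq_sum. Qed.

Lemma sum_le_card (P : pred T) V F k : {in V, forall y, F y <= k * P y} ->
  \sum_(y in V) F y <= k * #|[set y in V | P y]|.
Proof.
move=> Fk; apply: (@leq_trans (\sum_(y in V) k * P y)); first exact: leq_sum.
rewrite -big_distrr leq_mul2l /=.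
apply/orP; right; rewrite -sum1_card big_mkcond [leqRHS]big_mkcond /=.
by apply: leq_sum => y _; rewrite inE; case: (y \in V); case: (P y).
Qed.

End Charges.

(** * Discharging rules for the bounds 4, 9/2, 5 and 6 *)

Section Bounds.

Import Order.TTheory GRing.Theory Num.Theory.

Variables (T C : finType) (M t : nat) (e e' : rel T).
Hypothesis card_C : #|C| = M + t.
Hypotheses (sub : subrel e' e) (crit : critical C M t e').

Let e'_sym : symmetric e'. Proof. by case: crit. Qed.
Let e'_irr : irreflexive e'. Proof. by case: crit. Qed.
Let dM x : degree e' x <= M. Proof. by case: crit. Qed.
Let nbrE x y : y \in nbrs e' x = e' x y. Proof. by rewrite inE. Qed.
Let nbr_pos x y : e' x y -> 0 < degree e' y.
Proof. by move=> xy; apply/card_gt0P; exists x; rewrite inE e'_sym. Qed.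

Local Notation d := (degree e').

(** Charges [6 * d x], target 24: only 3-vertices are short, by 6. One with a neighbour of degree at
    most 4 takes 3 from each of the two others, which have degree [M]; any other 3-vertex takes 2
    from each neighbour. *)
Lemma mad_ge4 : t = 3 -> 7 <= M -> (4 <= mad e :> rat)%R.
Proof.
move=> t3 M7; have d3 x : 0 < d x -> 2 < d x.
  by apply: (no_low_degree card_C crit (k := 2)); rewrite t3.
pose bad y := [exists z, e' y z && (d z <= 4)].
pose r x y := if (d y == 3) && (5 <= d x) then
                if bad y then (if d x == M then 3 else 0) else 2
              else 0.
have -> : (4 = 24%:R / 6%:R :> rat)%R by [].
apply: (mad_discharging e'_sym e'_irr sub (r := r)) => //.
  by apply: (critical_edge crit); rewrite card_C; lia.
move=> x x0; have := d3 x x0; have dN : #|nbrs e' x| = d x by [].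
have r2 y : d x != M -> r x y <= 2 * (d y <= 3).
  by move=> /negPf xM; rewrite /r xM; case: eqVneq => [->|//]; case: (4 < d x); case: (bad _).
have r3 y : r x y <= 3 * (d y <= 3).
  by rewrite /r; case: eqVneq => [->|//]; case: (4 < d x); case: (bad _); case: (_ == M).
have le1 (b : bool) : b <= 1 by case: b.
have sum2 : d x != M -> \sum_(y in nbrs e' x) r x y <= 2 * d x.
  by move=> xM; rewrite -dN; apply: sum_le_const => y _; have := r2 y xM; have := le1 (d y <= 3); lia.
have sum3 : \sum_(y in nbrs e' x) r x y <= 3 * d x.
  by rewrite -dN; apply: sum_le_const => y _; have := r3 y; have := le1 (d y <= 3); lia.
have sum0 : d x <= 4 -> \sum_(y in nbrs e' x) r x y = 0.
  by move=> x4; apply: big1 => y _; rewrite /r ltnNge x4 andbF.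
rewrite leq_eqVlt => /orP[/eqP x3|]; last rewrite leq_eqVlt => /orP[/eqP x4|x5].
- rewrite sum0 -?x3 //; suff : 6 <= \sum_(y in nbrs e' x) r y x by lia.
  have [bad_x|good_x] := boolP (bad x).
    have /existsP[z /andP[xz z4]] := bad_x.
    have xz' : z \in nbrs e' x by rewrite nbrE.
    have card_z : #|nbrs e' x :\ z| = 2.
      by apply: succn_inj; rewrite x3 -dN (cardsD1 z (nbrs e' x)) xz'.
    rewrite (bigD1 z) //=; apply: (@leq_trans (\sum_(y in nbrs e' x :\ z) r y x)).
      rewrite (_ : 6 = 3 * #|nbrs e' x :\ z|); last by rewrite card_z.
      apply: sum_ge_const => y; rewrite in_setD1 nbrE => /andP[yz xy].
      have yM := full_degree_other_neighbors card_C crit t3 M7 (esym x3) xz z4 xy yz.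
      by rewrite /r -x3 yM bad_x !eqxx /= (leq_trans _ M7).
    rewrite (eq_bigl (fun y => (y \in nbrs e' x) && (y != z))) ?leq_addl //.
    by move=> y; rewrite in_setD1 andbC.
  rewrite (_ : 6 = 2 * #|nbrs e' x|); last by rewrite dN -x3.
  apply: sum_ge_const => y; rewrite nbrE => xy; rewrite /r -x3 (negPf good_x) /=.
  case: (ltnP 4 (d y)) => // y4; move: good_x; rewrite negb_exists => /forallP/(_ y).
  by rewrite xy y4.
- by rewrite sum0 -?x4 //; lia.
(* Below [M], gifts of 2 are affordable from degree 6 on; a 5-vertex can spare 6 and has at most
   three light neighbours. *)
have [xM|xM] := eqVneq (d x) M; last first.
  have [x6|x6] := ltnP 5 (d x); first by have := sum2 xM; lia.
  have few : #|[set y in nbrs e' x | d y <= 3]| < 4.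
    by apply: (few_light_neighbors card_C crit (h := 2) (r := 2)) => //; rewrite ?card_C; lia.
  have := sum_le_card (fun y _ => r2 y xM) (V := nbrs e' x).
  by lia.
have [M8|M8] := ltnP 7 M; first by move: sum3; lia.
have {M8} M7' : M = 7 by lia.
(* A 7-vertex can spare 18. Either no gift exceeds 2, or by [no_heavy_vertex] some neighbour
   receives nothing. *)
suff : \sum_(y in nbrs e' x) r x y <= 18 by lia.
have [none|] := boolP [forall y in nbrs e' x, r x y <= 2].
  apply: (@leq_trans (2 * #|nbrs e' x|)); last by rewrite dN xM M7'.
  by apply: sum_le_const => y yN; have /forall_inP := none; apply.
rewrite negb_forall_in => /existsP[u /andP[uN ru]].
have [u3 bad_u] : d u = 3 /\ bad u.
  move: ru; rewrite /r -ltnNge; case: eqP => // ->.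
  by case: (4 < d x) => //=; case: (bad u) => //=.
have /existsP[z /andP[uz z4]] := bad_u.
have C10 : #|C| = 10 by rewrite card_C M7' t3.
have [all3|] := boolP [forall y in nbrs e' x, d y <= 3].
  have crit7 : critical C 7 3 e' by rewrite -M7' -t3.
  have := no_heavy_vertex C10 crit7 (v := x) (u := u) (z := z).
  rewrite xM M7' => /(_ erefl) no_heavy; exfalso; apply: no_heavy => //.
    by move=> y yN; have /forall_inP := all3; apply.
  by rewrite -nbrE.
rewrite negb_forall_in => /existsP[w /andP[wN w4]].
apply: leq_trans (sum_le_card (fun y _ => r3 y)) _.
have : [set y in nbrs e' x | d y <= 3] \proper nbrs e' x.
  apply/properP; split; first by apply/subsetP => y; rewrite inE => /andP[].
  by exists w => //; rewrite inE wN (negPf w4).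
by move=> /proper_card; rewrite dN; lia.
Qed.

(** Charges [8 * d x], target 36. A 3-vertex lacks 12 and takes 4 from each neighbour, all of degree
    [M]; a 4-vertex lacks 4 and takes 1 from each neighbour. A 9-vertex can just spare 4 per edge,
    and a 5-vertex below [M] has at most four light neighbours. *)
Lemma mad_ge9_2 : t = 4 -> 9 <= M -> (9 / 2 <= mad e :> rat)%R.
Proof.
move=> t4 M9; have d3 x : 0 < d x -> 2 < d x.
  by apply: (no_low_degree card_C crit (k := 2)); rewrite t4.
pose r x y := if d y == 3 then 4 * (d x == M) else 1 * ((d y == 4) && (5 <= d x)).
have -> : (9 / 2 = 36%:R / 8%:R :> rat)%R by [].
apply: (mad_discharging e'_sym e'_irr sub (r := r)) => //.
  by apply: (critical_edge crit); rewrite card_C; lia.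
move=> x x0; have := d3 x x0; have dN : #|nbrs e' x| = d x by [].
have r1 y : d x != M -> r x y <= 1 * (d y <= 4).
  by move=> /negPf xM; rewrite /r xM; case: eqP => // _; case: eqVneq => [->|//]; case: (4 < d x).
have r4 y : r x y <= 4.
  by rewrite /r; case: (_ == 3); case: (_ == M); case: (_ == 4); case: (4 < d x).
have le1 (b : bool) : b <= 1 by case: b.
have sum1 : d x != M -> \sum_(y in nbrs e' x) r x y <= 1 * d x.
  by move=> xM; rewrite -dN; apply: sum_le_const => y _; have := r1 y xM; have := le1 (d y <= 4); lia.
have sum4 : \sum_(y in nbrs e' x) r x y <= 4 * d x.
  by rewrite -dN; apply: sum_le_const => y _.
have sum0 : d x <= 4 -> \sum_(y in nbrs e' x) r x y = 0.
  move=> x4; apply: big1 => y _; rewrite /r (ltnNge 4) x4 andbF.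
  have /negPf-> : d x != M by lia.
  by case: eqP.
rewrite leq_eqVlt => /orP[/eqP x3|]; last rewrite leq_eqVlt => /orP[/eqP x4|x5].
- rewrite sum0 -?x3 //; suff : 4 * #|nbrs e' x| <= \sum_(y in nbrs e' x) r y x.
    by rewrite dN; lia.
  apply: sum_ge_const => y; rewrite nbrE => xy; rewrite /r -x3 /=.
  have -> : d y = M; last by rewrite eqxx.
  by apply: (full_degree_neighbors card_C crit _ _ xy); lia.
- rewrite sum0 -?x4 //; suff : 1 * #|nbrs e' x| <= \sum_(y in nbrs e' x) r y x.
    by rewrite dN; lia.
  apply: sum_ge_const => y; rewrite nbrE => xy; rewrite /r -x4 /=.
  case: (ltnP 4 (d y)) => // y4; exfalso.
  by apply: (no_light_edge card_C crit xy (k := 4) (d := 4)); rewrite ?card_C; lia.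
have [xM|xM] := eqVneq (d x) M; first by move: sum4; lia.
have [x6|x6] := ltnP 5 (d x); first by have := sum1 xM; lia.
have few : #|[set y in nbrs e' x | d y <= 4]| < 5.
  by apply: (few_light_neighbors card_C crit (h := 3) (r := 3)) => //; rewrite ?card_C; lia.
have := sum_le_card (fun y _ => r1 y xM) (V := nbrs e' x).
by lia.
Qed.

(** Charges [4 * d x], target 20. Only 4-vertices are short, by 4; they take 1 from each neighbour,
    all of degree at least 6. A 6-vertex can spare 4 and has at most four light neighbours. *)
Lemma mad_ge5 : 5 <= t -> 13 <= M + t -> (5 <= mad e :> rat)%R.
Proof.
move=> t5 N13; have d4 x : 0 < d x -> 3 < d x.
  by apply: (no_low_degree card_C crit (k := 3)); lia.
pose r x y := 1 * ((d y == 4) && (6 <= d x)).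
have -> : (5 = 20%:R / 4%:R :> rat)%R by [].
apply: (mad_discharging e'_sym e'_irr sub (r := r)) => //.
  by apply: (critical_edge crit); rewrite card_C; lia.
move=> x x0; have := d4 x x0; have dN : #|nbrs e' x| = d x by [].
have r1 y : r x y <= 1 * (d y <= 4).
  by rewrite /r; case: eqVneq => [->|//]; case: (5 < d x).
have sum1 : \sum_(y in nbrs e' x) r x y <= 1 * d x.
  by rewrite -dN; apply: sum_le_const => y _; rewrite /r; case: (_ && _).
have sum0 : d x <= 5 -> \sum_(y in nbrs e' x) r x y = 0.
  by move=> x5; apply: big1 => y _; rewrite /r (ltnNge 5) x5 andbF.
rewrite leq_eqVlt => /orP[/eqP x4|x5].
  rewrite sum0 -?x4 //; suff : 1 * #|nbrs e' x| <= \sum_(y in nbrs e' x) r y x.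
    by rewrite dN; lia.
  apply: sum_ge_const => y; rewrite nbrE => xy; rewrite /r -x4 /=.
  case: (ltnP 5 (d y)) => // y5; exfalso.
  by apply: (no_light_edge card_C crit xy (k := 4) (d := 5)); rewrite ?card_C; lia.
have [x6|x6] := ltnP 5 (d x); last by rewrite sum0 //; lia.
have [x7|x7] := ltnP 6 (d x); first by move: sum1; lia.
have few : #|[set y in nbrs e' x | d y <= 4]| < 5.
  by apply: (few_light_neighbors card_C crit (h := 3) (r := 3)) => //; rewrite ?card_C; lia.
have := sum_le_card (fun y _ => r1 y) (V := nbrs e' x).
by lia.
Qed.

(** Charges [10 * d x], target 60. A 5-vertex lacks 10 and takes 2 from each neighbour, all of
    degree at least 7. A 4-vertex, possible only for [t = 6], lacks 20 and takes 5 from each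
    neighbour, all of degree [M], which [12 <= M] just makes affordable. *)
Lemma mad_ge6 : (t = 6 /\ 12 <= M) \/ (t = 7 /\ 8 <= M) -> (6 <= mad e :> rat)%R.
Proof.
move=> tM; have d4 x : 0 < d x -> 3 < d x.
  by apply: (no_low_degree card_C crit (k := 3)); lia.
have no4 x : t = 7 -> 0 < d x -> 4 < d x.
  by move=> t7; apply: (no_low_degree card_C crit (k := 4)); lia.
pose r x y := if d y == 5 then 2 * (7 <= d x) else 5 * ((d y == 4) && (d x == M)).
have -> : (6 = 60%:R / 10%:R :> rat)%R by [].
apply: (mad_discharging e'_sym e'_irr sub (r := r)) => //.
  by apply: (critical_edge crit); rewrite card_C; lia.
move=> x x0; have := d4 x x0; have dN : #|nbrs e' x| = d x by [].
have r2 y : d x != M -> r x y <= 2 * (d y <= 5).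
  by move=> /negPf xM; rewrite /r xM andbF; case: eqVneq => [->|//]; case: (6 < d x).
have r5 y : r x y <= 5.
  by rewrite /r; case: (_ == 5); case: (6 < d x); case: (_ == 4); case: (_ == M).
have le1 (b : bool) : b <= 1 by case: b.
have sum2 : d x != M \/ t = 7 -> \sum_(y in nbrs e' x) r x y <= 2 * d x.
  move=> xM; rewrite -dN; apply: sum_le_const => y; rewrite nbrE => xy.
  case: xM => [xM|t7]; first by have := r2 y xM; have := le1 (d y <= 5); lia.
  rewrite /r; case: eqP => _; first by case: (6 < d x).
  by have /negPf-> : d y != 4 by have := no4 y t7 (nbr_pos xy); lia.
have sum5 : \sum_(y in nbrs e' x) r x y <= 5 * d x.
  by rewrite -dN; apply: sum_le_const => y _.
have sum0 : d x <= 6 -> \sum_(y in nbrs e' x) r x y = 0.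
  move=> x6; apply: big1 => y _; rewrite /r (ltnNge 6) x6.
  have /negPf-> : d x != M by lia.
  by rewrite andbF; case: eqP.
rewrite leq_eqVlt => /orP[/eqP x4|]; last rewrite leq_eqVlt => /orP[/eqP x5|x6].
- have {tM} [t6 M12] : t = 6 /\ 12 <= M.
    by case: tM => // -[t7 _]; have := no4 x t7 x0; lia.
  rewrite sum0 -?x4 //; suff : 5 * #|nbrs e' x| <= \sum_(y in nbrs e' x) r y x.
    by rewrite dN; lia.
  apply: sum_ge_const => y; rewrite nbrE => xy; rewrite /r -x4 /=.
  have -> : d y = M; last by rewrite eqxx.
  by apply: (full_degree_neighbors card_C crit _ _ xy); lia.
- rewrite sum0 -?x5 //; suff : 2 * #|nbrs e' x| <= \sum_(y in nbrs e' x) r y x.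
    by rewrite dN; lia.
  apply: sum_ge_const => y; rewrite nbrE => xy; rewrite /r -x5 /=.
  case: (ltnP 6 (d y)) => // y6; exfalso.
  by apply: (no_light_edge card_C crit xy (k := 5) (d := 6)); rewrite ?card_C; lia.
have [x7|x7] := ltnP 6 (d x); last by rewrite sum0 //; lia.
have [xM|xM] := eqVneq (d x) M.
  by case: tM => [[t6 M12]|[t7 M8]]; [move: sum5|have := sum2 (or_intror t7)]; lia.
have [x8|x8] := ltnP 7 (d x); first by have := sum2 (or_introl xM); lia.
have few : #|[set y in nbrs e' x | d y <= 5]| < 6.
  by apply: (few_light_neighbors card_C crit (h := 3) (r := 3)) => //; rewrite ?card_C; lia.
have := sum_le_card (fun y _ => r2 y xM) (V := nbrs e' x).
by lia.
Qed.

End Bounds.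

(** * Bounds on the incidence chromatic number *)

Section Conclusion.

Import Order.TTheory.

Lemma incidence_bound_of_mad (T : finType) (e : rel T) (t : nat) (m : rat) :
  simple_graph e ->
  (forall e', subrel e' e -> critical 'I_(max_degree e + t) (max_degree e) t e' ->
     (m <= mad e)%R) ->
  (mad e < m)%R -> incidence_chromatic_number e <= max_degree e + t.
Proof.
move=> [e_sym e_irr] crit_mad mad_m.
have [|e' sub crit|c [c_col _]] := @colorable_no_critical T 'I_(max_degree e + t)
  (max_degree e) t e e_sym e_irr.
- by move=> x; apply: (leq_bigmax x).
- by have := crit_mad e' sub crit; rewrite leNgt mad_m.
by apply: (incidence_chromatic_number_le e_sym c_col); rewrite card_ord.
Qed.

End Conclusion.

Lemma incidence_bound_double (T : finType) (e : rel T) (N : nat) :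
  simple_graph e -> 2 <= N -> 2 * max_degree e <= N ->
  incidence_chromatic_number e <= N.
Proof.
move=> [e_sym e_irr] N2 dN.
(* The [maxn] keeps the label set non-empty when there is no edge; [2 <= N] accounts for it. *)
have [||c c_col] := @double_degree_coloring T e (maxn 1 (max_degree e)) e_sym e_irr.
- by rewrite leq_max.
- by move=> x; rewrite leq_max; apply/orP; right; apply: (leq_bigmax x).
apply: (incidence_chromatic_number_le e_sym c_col).
by rewrite card_prod card_ord card_bool; lia.
Qed.

Theorem theorem7 (T : finType) (e : rel T)
    (e_simple : simple_graph e)
    (T_nonempty : nonempty_graph T)
    (e_connected : connected_graph e) :
  ((mad e < 4)%R -> 7 <= max_degree e ->
     incidence_chromatic_number e <= max_degree e + 3) /\
  ((mad e < 9 / 2)%R -> 9 <= max_degree e ->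
     incidence_chromatic_number e <= max_degree e + 4) /\
  ((mad e < 5)%R -> 9 <= max_degree e \/ max_degree e <= 5 ->
     incidence_chromatic_number e <= max_degree e + 5) /\
  ((mad e < 5)%R -> 6 <= max_degree e <= 8 ->
     incidence_chromatic_number e <= max_degree e + 6) /\
  ((mad e < 6)%R -> 12 <= max_degree e \/ max_degree e <= 6 ->
     incidence_chromatic_number e <= max_degree e + 6) /\
  ((mad e < 6)%R -> 7 <= max_degree e <= 11 ->
     incidence_chromatic_number e <= max_degree e + 7).
Proof.
have card_C t : #|'I_(max_degree e + t)| = max_degree e + t by rewrite card_ord.
split; [|split; [|split; [|split; [|split]]]] => mad_lt deg.
- apply: incidence_bound_of_mad mad_lt => // e' sub crit.
  exact: (mad_ge4 (card_C 3) sub crit).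
- apply: incidence_bound_of_mad mad_lt => // e' sub crit.
  exact: (mad_ge9_2 (card_C 4) sub crit).
- case: deg => deg; last by apply: incidence_bound_double => //; lia.
  apply: incidence_bound_of_mad mad_lt => // e' sub crit.
  by apply: (mad_ge5 (card_C 5) sub crit); lia.
(* Degree 6 is covered by [2 * 6 = 6 + 6]; from degree 7 on there are the 13 colours that [mad_ge5]
   asks for. *)
- have [deg6|deg7] := leqP (max_degree e) 6; first by apply: incidence_bound_double => //; lia.
  apply: incidence_bound_of_mad mad_lt => // e' sub crit.
  by apply: (mad_ge5 (card_C 6) sub crit); lia.
- case: deg => deg; last by apply: incidence_bound_double => //; lia.
  apply: incidence_bound_of_mad mad_lt => // e' sub crit.
  by apply: (mad_ge6 (card_C 6) sub crit); left.
(* Likewise [2 * 7 = 7 + 7], which leaves the degrees from 8 on, as in [mad_ge6]. *)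
- have [deg7|deg8] := leqP (max_degree e) 7; first by apply: incidence_bound_double => //; lia.
  apply: incidence_bound_of_mad mad_lt => // e' sub crit.
  by apply: (mad_ge6 (card_C 7) sub crit); right.
Qed.
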